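(* Let $n$ be sufficiently large, $\mathbf{x}=(x_1,\dots,x_n)$, $\mathbb{F}$ a field of characteristic zero, and $k>1$. Let $P(T,\mathbf{x},z)\in\mathbb{F}[T,\mathbf{x},z]$ and $R_1,\dots,R_\ell\in\mathbb{F}[T,\mathbf{x}]$ satisfy: $P$ is computable by a depth-$\Delta$ circuit of size $s\le\mathrm{poly}(n)$; $P$ is $T$-regularized and monic in $z$; each $R_i$ is a truncated, non-degenerate, approximate $z$-root of $P$ of order $k$. Let $Q(T,\mathbf{x},z):=\left(\prod_{i\in[\ell]}(z-R_i(T,\mathbf{x}))\right)\operatorname{trunc} T^k$. Let $g$ be a $\sigma$-variate polynomial of degree $d$, $\mathcal{S}$ an $(n,\sigma,\mu,\rho)$-design, and $\mathbf{KI}_{g,\mathcal{S}}:\mathbb{F}^\mu\to\mathbb{F}^n$ the associated Kabanets–Impagliazzo map. If $Q(T,\mathbf{x},z)$ does not divide $P(T,\mathbf{x},z)$ but $Q(T,\mathbf{KI}_{g,\mathcal{S}}(\mathbf{w}),z)$ divides $P(T,\mathbf{KI}_{g,\mathcal{S}}(\mathbf{w}),z)$, then $g$ can be computed by an algebraic circuit of depth $\Delta'=O(\Delta)$ and size at most $s'=\mathrm{poly}(s,\ell,k,\deg(P))\cdot(\rho\log k)^{\mathrm{poly}(d)}$. In particular, if every depth-$\Delta'$ circuit for $g$ requires size greater than $s'$, then $Q(T,\mathbf{x},z)$ divides $P(T,\mathbf{x},z)$ if and only if $Q(T,\mathbf{KI}_{g,\mathcal{S}}(\mathbf{w}),z)$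 divides $P(T,\mathbf{KI}_{g,\mathcal{S}}(\mathbf{w}),z)$.
   Context: Circuits: unbounded fan-in sum/product gates, size = edges, depth = longest path; $O(\cdot)$ and $\mathrm{poly}$ are absolute. Monic in $z$: leading coefficient in $z$ a nonzero constant. $T$-regularized: $P(0,\mathbf{x},z)\in\mathbb{F}[z]$. $R$ is an approximate $z$-root of order $k$ if $P(T,\mathbf{x},R)\equiv0\bmod T^k$; truncated if $\deg_TR<k$; non-degenerate if $(\partial_zP)(0,\mathbf{0},R(0,\mathbf{0}))\ne0$. For a polynomial $F$, $F\operatorname{trunc}T^k$ is obtained by discarding all monomials of $T$-degree $\ge k$. An $(n,\sigma,\mu,\rho)$-design is $S_1,\dots,S_n\subseteq[\mu]$ with $|S_i|=\sigma$, $|S_i\cap S_j|<\rho$ for $i\ne j$; $\mathbf{KI}_{g,\mathcal{S}}(\mathbf{w})=(g(\mathbf{w}_{S_1}),\dots,g(\mathbf{w}_{S_n}))$ with $\mathbf{w}=(w_1,\dots,w_\mu)$, $\mathbf{w}_{S_i}=(w_j)_{j\in S_i}$, and composition substitutes $x_i\mapsto g(\mathbf{w}_{S_i})$. *)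

(* Defs.v *)
From HB Require Import structures.
From mathcomp Require Export all_boot all_order all_algebra.
From mathcomp Require Export mpoly.

Set Implicit Arguments.
Unset Strict Implicit.
Unset Printing Implicit Defensive.

Import GRing.Theory.
Local Open Scope ring_scope.

(** * Algebraic circuits *)

(* A circuit is a DAG with unbounded fan-in sum and product gates, listed in a
   topological order: the arguments of the gate at position i are positions
   j < i, repetitions (parallel edges) being allowed and counted.  The output is
   the last gate. *)
Inductive gate (F : Type) (N : nat) : Type :=
  | GVar of 'I_N
  | GConst of F
  | GSum of seq nat
  | GProd of seq nat.

Arguments GVar {F N} _.
Arguments GConst {F N} _.
Arguments GSum {F N} _.
Arguments GProd {F N} _.

Definition circuit (F : Type) (N : nat) : Type := seq (gate F N).

Section Circuits.
Context (F : fieldType) (N : nat).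
Implicit Types (C : circuit F N) (p : {mpoly F[N]}).

Definition gate_args (a : gate F N) : seq nat :=
  match a with
  | GVar _ | GConst _ => [::]
  | GSum js | GProd js => js
  end.

Definition circuit_wf C : Prop :=
  forall i, (i < size C)%N ->
    {in gate_args (nth (GConst 0) C i), forall j, (j < i)%N}.

Definition gate_value (vs : seq {mpoly F[N]}) (a : gate F N) : {mpoly F[N]} :=
  match a with
  | GVar i => 'X_i
  | GConst c => c%:MP
  | GSum js => \sum_(j <- js) vs`_j
  | GProd js => \prod_(j <- js) vs`_j
  end.

Definition circuit_values C : seq {mpoly F[N]} :=
  foldl (fun vs a => rcons vs (gate_value vs a)) [::] C.

Definition computes C p : Prop :=
  [/\ circuit_wf C, C <> [::] & last 0 (circuit_values C) = p].

Definition circuit_size C : nat := (\sum_(a <- C) size (gate_args a))%N.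

(* The i-th entry is the length of a longest path ending in gate i. *)
Definition circuit_depths C : seq nat :=
  foldl (fun ds a =>
    rcons ds (\max_(j <- gate_args a) (nth 0%N ds j).+1)%N) [::] C.

Definition circuit_depth C : nat := (\max_(e <- circuit_depths C) e)%N.

Definition computable p (Delta s : nat) : Prop :=
  exists C, [/\ computes C p, (circuit_depth C <= Delta)%N
              & (circuit_size C <= s)%N].

End Circuits.

(** * Polynomials *)

Definition divides (A : comNzRingType) (q p : A) : Prop :=
  exists h, p = h * q.

(* Total degree, with the convention that the zero polynomial has degree 0. *)
Definition tdeg (F : fieldType) (N : nat) (p : {mpoly F[N]}) : nat :=
  (msize p).-1.

(* F[T,x] is {mpoly F[n.+1]} and F[T,x,z] is {mpoly F[n.+2]}: T has index 0,
   x_i has index i.+1 and z has the last index n.+1 = ord_max.  Thus mwiden is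
   the inclusion of F[T,x] in F[T,x,z], and muni views an element of F[T,x,z] as
   a polynomial in z with coefficients in F[T,x]. *)
Section Polynomials.
Context (F : fieldType) (n : nat).
Implicit Types (P : {mpoly F[n.+2]}) (R : {mpoly F[n.+1]}).

Definition monic_in_z P : Prop :=
  exists2 c : F, c != 0 & lead_coef (muni P) = c%:MP.

Definition T_regularized P : Prop :=
  exists p : {poly F},
    P \mPo [tuple if i == ord0 then 0 else 'X_i | i < n.+2]
      = (map_poly (@mpolyC n.+2 F) p).['X_ord_max].

Definition approx_root (k : nat) P R : Prop :=
  divides ('X_ord0 ^+ k) (muni P).[R].

Definition truncated (k : nat) R : Prop :=
  forall m, m \in msupp R -> (m ord0 < k)%N.

Definition nondegenerate P R : Prop :=
  (P^`M(ord_max)).@[fun i => if i == ord_max then R.@[fun=> 0] else 0] != 0.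

Definition truncT (k : nat) P : {mpoly F[n.+2]} :=
  \sum_(m <- msupp P | (m ord0 < k)%N) P@_m *: 'X_[m].

Definition Qpoly (k l : nat) (R : 'I_l -> {mpoly F[n.+1]}) : {mpoly F[n.+2]} :=
  truncT k (\prod_(i < l) ('X_ord_max - mwiden (R i))).

End Polynomials.

(* The index of x_i among the variables T, x_0, .., x_(n-1), z. *)
Definition xindex (n : nat) (i : 'I_n) : 'I_n.+2 :=
  lift ord0 (widen_ord (leqnSn n) i).

(* P(T, h(w), z) for a polynomial map h with coordinates in F[w_1..w_mu] *)
Definition subst_x (F : fieldType) (n mu : nat)
    (h : 'I_n -> {mpoly F[mu]}) (P : {mpoly F[n.+2]}) : {mpoly F[mu.+2]} :=
  P \mPo [tuple of 'X_ord0
            :: rcons [tuple h i \mPo [tuple 'X_(xindex j) | j < mu] | i < n]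
                     'X_ord_max].

(** * The Kabanets-Impagliazzo map *)

Definition design (n sigma mu rho : nat) (S : 'I_n -> {set 'I_mu}) : Prop :=
  (forall i, #|S i| = sigma) /\
  (forall i j, i != j -> (#|S i :&: S j| < rho)%N).

(* g(w_{S_i}), the elements of S_i being taken in increasing order; the default
   value of nth is never used, since S_i has sigma elements in a design. *)
Definition KI (F : fieldType) (n sigma mu : nat) (g : {mpoly F[sigma]})
    (S : 'I_n -> {set 'I_mu}) (i : 'I_n) : {mpoly F[mu]} :=
  g \mPo [tuple [seq 'X_v | v <- enum (S i)]`_j | j < sigma].

(** * Asymptotic bounds *)

(* Every polynomial in natural-number quantities xs is bounded by
   poly_bound c xs for some constant c, and poly_bound c is itself a polynomial:
   a bound poly(xs) is a bound poly_bound c xs for some constant c. *)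
Definition poly_bound (c : nat) (xs : seq nat) : nat :=
  (c * (sumn xs).+1 ^ c)%N.

(* poly(s, l, k, D) * (rho * log k)^poly(d), with log in base 2 rounded up.  As
   (up_log 2 k) is at most (log_2 k)^2 for k > 1, rounding only affects the
   constant c2. *)
Definition size_bound (c1 c2 s l k D rho d : nat) : nat :=
  (poly_bound c1 [:: s; l; k; D] * (rho * up_log 2 k) ^ poly_bound c2 [:: d])%N.

(* Main.v *)
(** Write P over F[x][T][z].  As P is T-regularized, each root R i is a constant
    r i at T = 0, and as it is simple there, Hensel's lemma lifts R i to a root
    Rh i modulo T^M, with M polynomial in deg P and k.  When the r i are
    distinct, Q divides P if and only if the coefficients of
    prod_i (z - Rh i) at T^j z^e vanish for k <= j < M.  If divisibility holds
    after the substitution only, then the r i are distinct and one of these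
    coefficients, G, is nonzero while G o KI = 0.  Lagrange inversion expresses
    Rh i through a coefficient of a polynomial in P, so G has a circuit of depth
    Delta + O(1); coefficients are extracted by interpolation.

    The hybrid argument replaces the coordinates of KI by constants and fixes the
    variables outside one S i.  It gives a nonzero polynomial Phi with Phi g = 0,
    whose coefficients involve g only through restrictions to fewer than rho
    variables, which have at most rho^d monomials.  A derivative of Phi has g as
    a simple root at some point a, so that Lagrange inversion along the line
    a + T (u - a) recovers g.  For rho = 1 the coefficients of Phi are constants,
    hence so is g. *)

From HB Require Import structures.
Require Import Defs.
From Stdlib Require Classical_Prop.
From mathcomp Require Import zify ring.

Set Implicit Arguments.
Unset Strict Implicit.
Unset Printing Implicit Defensive.

Import GRing.Theory.
Local Open Scope ring_scope.

(** * Circuits as nets of gates *)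

(** The truncation Q is in general not a product of linear factors, so it cannot be compared with
    the roots of P directly. What replaces this is uniqueness of Hensel factorization: a factor of P
    that agrees with prod_i (z - Rh i) modulo T agrees with it modulo T^M. As Q has T-degree below
    k, divisibility forces the coefficients of the product at T^j to vanish from j = k on. The
    converse needs M to exceed the T-degree of the remainder of P by Q.

    Sizes and degrees are measured as powers of one base W. The construction has a fixed number of
    stages, each adding a constant to the depth and changing the exponent of W in an absolute way.
    The bound s' does not mention n, so no stage may pay for all the variables.

    Two boundary cases escape this accounting. Depth Delta + O(1) is O(Delta) only for Delta > 0, so
    P of depth 0 is excluded by a separate property of the witness. And (rho log k)^poly(d) equals 1
    for rho = 1 and k = 2, whereas the general construction costs at least d. *)

Section Nets.
Context (F : fieldType) (N : nat).
Implicit Types (C : circuit F N) (p : {mpoly F[N]}) (a : gate F N).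

Definition gate_at C i : gate F N := nth (GConst 0) C i.

Definition gate_eval (v : nat -> {mpoly F[N]}) a : {mpoly F[N]} :=
  match a with
  | GVar i => 'X_i
  | GConst c => c%:MP
  | GSum js => \sum_(j <- js) v j
  | GProd js => \prod_(j <- js) v j
  end.

Lemma eq_gate_eval (v w : nat -> {mpoly F[N]}) a :
  {in gate_args a, v =1 w} -> gate_eval v a = gate_eval w a.
Proof. by case: a => //= js vw; apply: eq_big_seq. Qed.

(* The gate i has the value v i, and h i bounds the length of the paths that
   end in it. *)
Definition net C (v : nat -> {mpoly F[N]}) (h : nat -> nat) (D : nat) : Prop :=
  forall i, (i < size C)%N ->
  [/\ {in gate_args (gate_at C i), forall j, (j < i)%N /\ (h j < h i)%N},
      v i = gate_eval v (gate_at C i) & (h i <= D)%N].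

(** Several outputs at arbitrary gates: circuits are placed side by side before the gate that
    combines them is appended, while [computes] wants one output, in last position. *)
Definition realizable (ps : seq {mpoly F[N]}) (D s : nat) : Prop :=
  exists C v h, [/\ net C v h D, (circuit_size C <= s)%N
    & {in ps, forall p, exists2 i, (i < size C)%N & v i = p}].

Lemma circuit_values_rcons C a :
  circuit_values (rcons C a)
    = rcons (circuit_values C) (gate_value (circuit_values C) a).
Proof. by rewrite /circuit_values -cats1 foldl_cat. Qed.

Lemma size_circuit_values C : size (circuit_values C) = size C.
Proof.
elim/last_ind: C => // C a IH.
by rewrite circuit_values_rcons !size_rcons IH.
Qed.

Lemma circuit_depths_rcons C a :
  circuit_depths (rcons C a)
    = rcons (circuit_depths C)
        (\max_(j <- gate_args a) (nth 0%N (circuit_depths C) j).+1)%N.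
Proof. by rewrite /circuit_depths -cats1 foldl_cat. Qed.

Lemma size_circuit_depths C : size (circuit_depths C) = size C.
Proof.
elim/last_ind: C => // C a IH.
by rewrite circuit_depths_rcons !size_rcons IH.
Qed.

Lemma gate_at_rcons C a i :
  gate_at (rcons C a) i =
    if (i < size C)%N then gate_at C i
    else if i == size C then a else GConst 0.
Proof. by rewrite /gate_at nth_rcons. Qed.

Lemma circuit_wf_rcons C a :
  circuit_wf (rcons C a) ->
  circuit_wf C /\ {in gate_args a, forall j, (j < size C)%N}.
Proof.
move=> wf; split=> [i iC|].
  have := wf i; rewrite size_rcons => /(_ (ltnW iC)).
  by rewrite nth_rcons iC.
have := wf (size C); rewrite size_rcons => /(_ (ltnSn _)).
by rewrite nth_rcons ltnn eqxx.
Qed.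

Lemma gate_value_eval vs a (v : nat -> {mpoly F[N]}) :
  {in gate_args a, forall j, vs`_j = v j} -> gate_value vs a = gate_eval v a.
Proof. by case: a => //= js vw; apply: eq_big_seq. Qed.

Lemma nth_circuit_values C i : circuit_wf C -> (i < size C)%N ->
  (circuit_values C)`_i
    = gate_eval (fun j => (circuit_values C)`_j) (gate_at C i).
Proof.
elim/last_ind: C => // C a IH /circuit_wf_rcons[wf aC].
rewrite size_rcons ltnS leq_eqVlt circuit_values_rcons gate_at_rcons.
case: (ltngtP i (size C)) => //= [iC _|-> _]; last first.
  rewrite nth_rcons size_circuit_values ltnn eqxx.
  apply: gate_value_eval => j ja.
  by rewrite nth_rcons size_circuit_values aC.
rewrite nth_rcons size_circuit_values iC IH //.
apply: eq_gate_eval => j /wf ja.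
by rewrite nth_rcons size_circuit_values (ltn_trans (ja iC)).
Qed.

Lemma nth_circuit_depths C i : circuit_wf C -> (i < size C)%N ->
  nth 0%N (circuit_depths C) i
    = (\max_(j <- gate_args (gate_at C i)) (nth 0 (circuit_depths C) j).+1)%N.
Proof.
elim/last_ind: C => // C a IH /circuit_wf_rcons[wf aC].
rewrite size_rcons ltnS leq_eqVlt circuit_depths_rcons gate_at_rcons.
case: (ltngtP i (size C)) => //= [iC _|-> _]; last first.
  rewrite nth_rcons size_circuit_depths ltnn eqxx.
  apply: eq_big_seq => j ja.
  by rewrite nth_rcons size_circuit_depths aC.
rewrite nth_rcons size_circuit_depths iC IH //.
apply: eq_big_seq => j /wf ja.
by rewrite nth_rcons size_circuit_depths (ltn_trans (ja iC)).
Qed.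

Lemma circuit_net C D : circuit_wf C -> (circuit_depth C <= D)%N ->
  net C (fun i => (circuit_values C)`_i)
        (fun i => nth 0%N (circuit_depths C) i) D.
Proof.
move=> wf CD i iC; split; last 1 first.
- apply: leq_trans CD; rewrite /circuit_depth.
  by apply: leq_bigmax_seq => //; rewrite mem_nth // size_circuit_depths.
- move=> j ja; split; first exact: wf iC j ja.
  rewrite (nth_circuit_depths wf iC).
  by rewrite (big_rem j) //= leq_max ltnSn.
- exact: nth_circuit_values.
Qed.

Lemma computable_realizable p D s :
  computable p D s -> realizable [:: p] D s.
Proof.
case=> C [[wf C0 pE] CD Cs]; exists C.
exists (fun i => (circuit_values C)`_i).
exists (fun i => nth 0%N (circuit_depths C) i).
split=> //; first exact: circuit_net.
move=> q; rewrite inE => /eqP ->; exists (size C).-1.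
  by case: (C) C0.
by rewrite -pE -size_circuit_values nth_last.
Qed.

Lemma net_wf C v h D : net C v h D -> circuit_wf C.
Proof. by move=> nC i /nC[Ca _ _] j /Ca[]. Qed.

(** The gate equations determine the values, because the arguments of a gate precede it. *)
Lemma net_values C v h D i : net C v h D -> (i < size C)%N ->
  (circuit_values C)`_i = v i.
Proof.
move=> nC; have wf := net_wf nC.
elim/ltn_ind: i => i IH iC; rewrite (nth_circuit_values wf iC).
case: (nC i iC) => Ca -> _; apply: eq_gate_eval => j /Ca[ji _].
exact: IH (ltn_trans ji iC).
Qed.

Lemma net_depths C v h D i : net C v h D -> (i < size C)%N ->
  (nth 0%N (circuit_depths C) i <= h i)%N.
Proof.
move=> nC; have wf := net_wf nC.
elim/ltn_ind: i => i IH iC; rewrite (nth_circuit_depths wf iC).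
case: (nC i iC) => Ca _ _; apply/bigmax_leqP_seq => j /Ca[ji hj] _.
exact: leq_ltn_trans (IH j ji (ltn_trans ji iC)) hj.
Qed.

Lemma net_rcons C v h D a : net C v h D ->
  {in gate_args a, forall j, (j < size C)%N} ->
  net (rcons C a)
    (fun i => if (i < size C)%N then v i else gate_eval v a)
    (fun i => if (i < size C)%N then h i else D.+1) D.+1.
Proof.
move=> nC aC i; rewrite size_rcons ltnS leq_eqVlt gate_at_rcons.
case: (ltngtP i (size C)) => //= [iC _|-> _].
  case: (nC i iC) => Ca vE hD; split; last exact: leqW.
  - by move=> j /Ca[ji]; rewrite (ltn_trans ji iC).
  - rewrite vE; apply: eq_gate_eval => j /Ca[ji _].
    by rewrite (ltn_trans ji iC).
split=> //; first by move=> j /aC jC; rewrite jC ltnS; case: (nC j jC).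
by apply: eq_gate_eval => j /aC ->.
Qed.

Lemma circuit_size_rcons C a :
  circuit_size (rcons C a) = (circuit_size C + size (gate_args a))%N.
Proof. by rewrite /circuit_size -cats1 big_cat big_seq1. Qed.

Lemma circuit_size_cat C C' :
  circuit_size (C ++ C') = (circuit_size C + circuit_size C')%N.
Proof. by rewrite /circuit_size big_cat. Qed.

(** The output has to be the last gate: a unary sum copies gate i there, for one level and one
    edge. *)
Lemma realizable_computable p D s :
  realizable [:: p] D s -> computable p D.+1 s.+1.
Proof.
case=> C [v [h [nC Cs /(_ p (mem_head _ _))[i iC vi]]]].
exists (rcons C (GSum [:: i])).
have aC : {in gate_args (GSum [:: i] : gate F N), forall j, (j < size C)%N}.
  by move=> j /=; rewrite inE => /eqP ->.
have nC' := net_rcons nC aC; split; last first.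
- by rewrite circuit_size_rcons /= addn1.
- apply/bigmax_leqP_seq => e /(nthP 0%N)[j]; rewrite size_circuit_depths.
  move=> jC <- _; apply: leq_trans (net_depths nC' jC) _.
  by case: (nC' j jC).
split; first exact: net_wf nC'; first by case: (C).
rewrite -nth_last size_circuit_values size_rcons /=.
rewrite (net_values nC') ?size_rcons // ltnn /=.
by rewrite big_seq1.
Qed.

Lemma realizable_mono ps qs D D' s s' : {subset qs <= ps} ->
  (D <= D')%N -> (s <= s')%N -> realizable ps D s -> realizable qs D' s'.
Proof.
move=> qp DD ss [C [v [h [nC Cs psC]]]]; exists C, v, h; split.
- by move=> i /nC[Ca vE hD]; split=> //; apply: leq_trans DD.
- exact: leq_trans ss.
- by move=> q /qp /psC.
Qed.

Lemma realizable_nil D s : realizable [::] D s.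
Proof.
exists [::], (fun=> 0), (fun=> 0%N).
by split=> //; rewrite /circuit_size big_nil.
Qed.

Definition shift_gate (m : nat) a : gate F N :=
  match a with
  | GVar i => GVar i
  | GConst c => GConst c
  | GSum js => GSum (map (addn m) js)
  | GProd js => GProd (map (addn m) js)
  end.

Lemma gate_args_shift m a : gate_args (shift_gate m a) = map (addn m) (gate_args a).
Proof. by case: a. Qed.

Lemma gate_eval_shift m v a :
  gate_eval v (shift_gate m a) = gate_eval (fun j => v (m + j)%N) a.
Proof. by case: a => //= js; rewrite big_map. Qed.

Lemma ltn_addl_false m n : (m + n < m)%N = false.
Proof. by rewrite ltnNge leq_addr. Qed.

Lemma net_cat C v h C' v' h' D : net C v h D -> net C' v' h' D ->
  net (C ++ map (shift_gate (size C)) C')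
    (fun i => if (i < size C)%N then v i else v' (i - size C)%N)
    (fun i => if (i < size C)%N then h i else h' (i - size C)%N) D.
Proof.
move=> nC nC' i; rewrite size_cat size_map /gate_at nth_cat.
case: (ltnP i (size C)) => [iC _|iC iC'].
  case: (nC i iC) => Ca vE hD; split=> //.
  - by move=> j /Ca[ji]; rewrite (ltn_trans ji iC).
  - rewrite vE; apply: eq_gate_eval => j /Ca[ji _].
    by rewrite (ltn_trans ji iC).
set k := (i - size C)%N; have kC : (k < size C')%N by rewrite ltn_subLR.
have iE : i = (size C + k)%N by rewrite subnKC.
case: (nC' k kC) => Ca vE hD.
rewrite (nth_map (GConst 0)) // gate_args_shift; split=> //.
- move=> j /mapP[j' /Ca[jk hj] ->].
  by rewrite iE ltn_add2l jk !ltn_addl_false !addKn.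
- rewrite gate_eval_shift vE; apply: eq_gate_eval => j /Ca[jk _].
  by rewrite ltn_addl_false addKn.
Qed.

Lemma circuit_size_shift m C :
  circuit_size (map (shift_gate m) C) = circuit_size C.
Proof.
rewrite /circuit_size big_map; apply: eq_bigr => a _.
by rewrite gate_args_shift size_map.
Qed.

Lemma realizable_cat ps qs D s t :
  realizable ps D s -> realizable qs D t -> realizable (ps ++ qs) D (s + t).
Proof.
case=> C [v [h [nC Cs psC]]] [C' [v' [h' [nC' Cs' qsC]]]].
do 3 eexists; split; first exact: net_cat nC nC'.
  by rewrite circuit_size_cat circuit_size_shift leq_add.
move=> p; rewrite mem_cat size_cat size_map => /orP[/psC|/qsC] [i iC iE].
  by exists i; rewrite ?iC // ltn_addr.
by exists (size C + i)%N; rewrite ?ltn_add2l // ltn_addl_false addKn.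
Qed.

Lemma realizable_map (I : eqType) (r : seq I) (f : I -> {mpoly F[N]}) D s :
  {in r, forall i, realizable [:: f i] D s} ->
  realizable (map f r) D (size r * s).
Proof.
elim: r => [|i r IH] fD /=; first exact: realizable_nil.
rewrite mulSn -cat1s; apply: realizable_cat; first exact/fD/mem_head.
by apply: IH => j jr; apply: fD; rewrite inE jr orbT.
Qed.

(** The new gate is chosen after the circuit, since its arguments are the positions where the ps are
    found. *)
Lemma realizable_gate ps D s t q : realizable ps D s ->
  (forall v : nat -> {mpoly F[N]}, forall m : nat,
     {in ps, forall p, exists2 i, (i < m)%N & v i = p} ->
     exists a, [/\ {in gate_args a, forall j, (j < m)%N},
                   gate_eval v a = q & (size (gate_args a) <= t)%N]) ->
  realizable [:: q] D.+1 (s + t).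
Proof.
case=> C [v [h [nC Cs psC]]] /(_ v (size C) psC)[b [bC bE bs]].
exists (rcons C b); do 2 eexists; split; first exact: net_rcons nC bC.
  by rewrite circuit_size_rcons leq_add.
move=> p; rewrite inE => /eqP ->; exists (size C).
  by rewrite size_rcons.
by rewrite ltnn.
Qed.

Lemma positions ps (v : nat -> {mpoly F[N]}) m :
  {in ps, forall p, exists2 i, (i < m)%N & v i = p} ->
  exists js, [/\ size js = size ps, {in js, forall j, (j < m)%N}
               & map v js = ps].
Proof.
elim: ps => [|p ps IH] H; first by exists [::].
have [|js [sz jm vE]] := IH; first by move=> q qs; apply: H; rewrite inE qs orbT.
have [i im vi] := H p (mem_head _ _).
exists (i :: js); split=> /=; [by rewrite sz| |by rewrite vi vE].
by move=> j; rewrite inE => /predU1P[->|/jm].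
Qed.

Lemma realizable_sum ps D s : realizable ps D s ->
  realizable [:: \sum_(p <- ps) p] D.+1 (s + size ps).
Proof.
move=> psD; apply: realizable_gate psD _ => v m /positions[js [sz jm vE]].
by exists (GSum js); split=> //=; rewrite ?sz // -vE big_map.
Qed.

Lemma realizable_prod ps D s : realizable ps D s ->
  realizable [:: \prod_(p <- ps) p] D.+1 (s + size ps).
Proof.
move=> psD; apply: realizable_gate psD _ => v m /positions[js [sz jm vE]].
by exists (GProd js); split=> //=; rewrite ?sz // -vE big_map.
Qed.

Lemma realizable_atom a D s :
  gate_args a = [::] -> realizable [:: gate_eval (fun=> 0) a] D s.
Proof.
move=> a0; exists [:: a], (fun=> gate_eval (fun=> 0) a), (fun=> 0%N); split.
- move=> [|//] _; split=> //=; first by rewrite /gate_at /= a0.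
  by apply: eq_gate_eval => j; rewrite /gate_at a0.
- by rewrite /circuit_size big_seq1 a0.
- by move=> p; rewrite inE => /eqP ->; exists 0%N.
Qed.

Lemma realizable_C c D s : realizable [:: c%:MP] D s.
Proof. exact: (@realizable_atom (GConst c)). Qed.

Lemma realizable_X i D s : realizable [:: 'X_i] D s.
Proof. exact: (@realizable_atom (GVar i)). Qed.

End Nets.

Section Substitution.
Context (F : fieldType) (N N' : nat) (lq : N.-tuple {mpoly F[N']}).
Implicit Types (C : circuit F N) (p : {mpoly F[N]}) (a : gate F N).

Definition gate_var a : option 'I_N := if a is GVar k then Some k else None.

(** A variable gate becomes an idle constant, so that the other gates keep their positions; its
    readers are redirected by w to a gate that computes the substituted polynomial. *)
Definition rewire (w : nat -> nat) a : gate F N' :=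
  match a with
  | GVar _ => GConst 0
  | GConst c => GConst c
  | GSum js => GSum (map w js)
  | GProd js => GProd (map w js)
  end.

Lemma gate_args_rewire w a : gate_args (rewire w a) = map w (gate_args a).
Proof. by case: a. Qed.

Lemma gate_eval_rewire w a u v : gate_var a = None ->
  {in gate_args a, forall j, u (w j) = v j \mPo lq} ->
  gate_eval u (rewire w a) = gate_eval v a \mPo lq.
Proof.
case: a => //= [c|js|js] _ uv; first by rewrite comp_mpolyC.
  by rewrite big_map raddf_sum; apply: eq_big_seq.
by rewrite big_map rmorph_prod; apply: eq_big_seq.
Qed.

(* Only the variables read by some gate, at most s + 1 of them, have to be
   substituted: the bound does not depend on N. *)
Lemma realizable_subst p D s D' s' :
  realizable [:: p] D s -> (forall i, realizable [:: tnth lq i] D' s') ->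
  realizable [:: p \mPo lq] (D + D') (s + s.+1 * s').
Proof.
case=> C [v [h [nC Cs /(_ p (mem_head _ _))[i0 i0C vi0]]]] lqD.
(* The output gate is listed too, as it may itself be a variable: hence [s.+1]. *)
pose used := i0 :: flatten [seq gate_args a | a <- C].
have su : (size used <= s.+1)%N.
  rewrite /= ltnS size_flatten /shape -map_comp sumnE big_map.
  exact: leq_trans Cs.
have argu i j : (i < size C)%N -> j \in gate_args (gate_at C i) -> j \in used.
  move=> iC ja; rewrite inE; apply/orP; right; apply/flattenP.
  exists (gate_args (gate_at C i)) => //.
  by rewrite -(nth_map _ [::]) // mem_nth // size_map.
pose gv j := gate_var (gate_at C j).
pose V := pmap gv used.
have [C0 [v0 [h0 [nC0 C0s VC0]]]] :
    realizable [seq tnth lq k | k <- V] D' (s.+1 * s').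
  have := @realizable_map _ _ _ V (tnth lq) D' s' (fun k _ => lqD k).
  apply: realizable_mono => //; rewrite leq_mul2r; apply/orP; right.
  apply: leq_trans su.
  by rewrite size_pmap count_size.
have [pos posP] : exists pos : 'I_N -> nat,
    {in V, forall k, (pos k < size C0)%N /\ v0 (pos k) = tnth lq k}.
  have /fin_all_exists H : forall k, exists i,
      k \in V -> (i < size C0)%N /\ v0 i = tnth lq k.
    move=> k; case: (boolP (k \in V)) => [kV|_]; last by exists 0%N.
    by have [i iC iE] := VC0 _ (map_f _ kV); exists i.
  by have [f fP] := H; exists f.
pose w j := if gv j is Some k then pos k else (size C0 + j)%N.
have wV j k : j \in used -> gv j = Some k -> k \in V.
  by move=> ju gj; rewrite mem_pmap -gj map_f.
have gX j k : (j < size C)%N -> gv j = Some k -> v j = 'X_k.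
  move=> jC; rewrite /gv; case: (nC j jC) => _ -> _.
  by case: (gate_at C j) => //= i [->].
pose C1 := C0 ++ map (rewire w) C.
pose v1 i := if (i < size C0)%N then v0 i
  else if gv (i - size C0)%N is Some _ then 0
  else v (i - size C0)%N \mPo lq.
pose h1 i := if (i < size C0)%N then h0 i else (D' + h (i - size C0))%N.
have v1w j : j \in used -> (j < size C)%N -> v1 (w j) = v j \mPo lq.
  move=> ju jC; rewrite /v1 /w; case gj: (gv j) => [k|].
    have [pk ->] := posP k (wV j k ju gj).
    by rewrite pk (gX _ _ jC gj) comp_mpolyXU -tnth_nth.
  by rewrite ltn_addl_false addKn gj.
have wC j : j \in used -> (j < size C)%N ->
    (w j < size C1)%N /\ (h1 (w j) <= D' + h j)%N.
  move=> ju jC; rewrite /w /h1 size_cat size_map.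
  case gj: (gv j) => [k|]; last by rewrite ltn_addl_false addKn ltn_add2l.
  have [pk _] := posP k (wV j k ju gj).
  by rewrite pk ltn_addr // (leq_trans _ (leq_addr _ _)) //; case: (nC0 _ pk).
have nC1 : net C1 v1 h1 (D + D').
  move=> i; rewrite size_cat size_map /gate_at nth_cat /v1 /h1.
  case: (ltnP i (size C0)) => [iC _|iC iC'].
    case: (nC0 i iC) => Ca vE hD; split=> //.
    - by move=> j /Ca[ji]; rewrite (ltn_trans ji iC).
    - rewrite vE; apply: eq_gate_eval => j /Ca[ji _].
      by rewrite (ltn_trans ji iC).
    - exact: leq_trans hD (leq_addl _ _).
  set k := (i - size C0)%N; have kC : (k < size C)%N by rewrite ltn_subLR.
  have iE : i = (size C0 + k)%N by rewrite subnKC.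
  case: (nC k kC) => Ca vE hD.
  rewrite (nth_map (GConst 0)) // gate_args_rewire; split=> //.
  - move=> _ /mapP[j ja ->]; have [jk hj] := Ca j ja.
    have ju := argu _ _ kC ja; have jC := ltn_trans jk kC.
    have [_ hw] := wC j ju jC; split; last first.
      by apply: leq_ltn_trans hw _; rewrite ltn_add2l.
    rewrite iE /w; case gj: (gv j) => [m|]; last by rewrite ltn_add2l.
    by rewrite ltn_addr //; case: (posP m (wV _ _ ju gj)).
  - case gk: (gv k) => [m|].
      by move: gk; rewrite /gv /gate_at; case: (nth _ _ _).
    rewrite vE; symmetry; apply: (gate_eval_rewire gk) => j ja.
    have [jk hj] := Ca j ja; apply: v1w; last exact: ltn_trans kC.
    exact: argu kC ja.
  - by rewrite addnC leq_add2r.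
exists C1, v1, h1; split=> //.
  rewrite circuit_size_cat addnC leq_add //; apply: leq_trans Cs.
  rewrite /circuit_size big_map; apply: leq_sum => a _.
  by rewrite gate_args_rewire size_map.
move=> q; rewrite inE => /eqP ->; exists (w i0).
  by case: (wC i0 (mem_head _ _) i0C).
by rewrite v1w ?mem_head // vi0.
Qed.

End Substitution.

(** * Size and degree bounds *)

Section TotalDegree.
Context (F : fieldType) (N : nat).
Implicit Types (p q : {mpoly F[N]}).

Lemma tdeg_leP p B :
  reflect {in msupp p, forall m, (mdeg m <= B)%N} (tdeg p <= B)%N.
Proof.
have -> : (tdeg p <= B)%N = (msize p <= B.+1)%N.
  by rewrite /tdeg -subn1 leq_subLR add1n.
rewrite msizeE; apply: (iffP (bigmax_leqP_seq _ _ _ _)) => H m mp; first exact: H m mp isT.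
by move=> _; apply: H.
Qed.

Lemma tdegD p q B :
  (tdeg p <= B)%N -> (tdeg q <= B)%N -> (tdeg (p + q) <= B)%N.
Proof.
move=> pB qB; apply/tdeg_leP => m /msuppD_le; rewrite mem_cat.
by move=> /orP[]; move: m; apply/tdeg_leP.
Qed.

Lemma tdegC c : tdeg (c%:MP : {mpoly F[N]}) = 0%N.
Proof. by rewrite /tdeg msizeC; case: (c != 0). Qed.

Lemma tdeg_sum (I : Type) (r : seq I) (f : I -> {mpoly F[N]}) B :
  (forall i, (tdeg (f i) <= B)%N) -> (tdeg (\sum_(i <- r) f i) <= B)%N.
Proof.
move=> fB; elim/big_ind: _ => // [|p q pB qB]; first by rewrite -mpolyC0 tdegC.
exact: tdegD.
Qed.

Lemma tdegXU i : tdeg ('X_i : {mpoly F[N]}) = 1%N.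
Proof. by rewrite /tdeg msizeX mdeg1. Qed.

Lemma tdegM p q : (tdeg (p * q) <= tdeg p + tdeg q)%N.
Proof.
have [->|p0] := eqVneq p 0; first by rewrite mul0r /tdeg msize0.
have [->|q0] := eqVneq q 0; first by rewrite mulr0 /tdeg msize0.
rewrite /tdeg msizeM //; move: (msize p) (msize q) => a b; lia.
Qed.

Lemma tdegX p m : (tdeg (p ^+ m) <= m * tdeg p)%N.
Proof.
elim: m => [|m IH]; first by rewrite expr0 -mpolyC1 tdegC.
by rewrite exprS mulSn (leq_trans (tdegM _ _)) // leq_add2l.
Qed.

Lemma tdeg_prod (I : Type) (r : seq I) (f : I -> {mpoly F[N]}) (e : I -> nat) :
  (forall i, (tdeg (f i) <= e i)%N) ->
  (tdeg (\prod_(i <- r) f i) <= \sum_(i <- r) e i)%N.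
Proof.
move=> fe; elim/big_ind2: _ => [|p m q k pm qk|//].
  by rewrite -mpolyC1 tdegC.
by apply: leq_trans (tdegM _ _) (leq_add pm qk).
Qed.

Lemma tdegZ c p : (tdeg (c *: p) <= tdeg p)%N.
Proof. by rewrite -mul_mpolyC (leq_trans (tdegM _ _)) // tdegC. Qed.

End TotalDegree.

Lemma tdeg_comp (F : fieldType) N N' (p : {mpoly F[N]}) (lq : N.-tuple {mpoly F[N']}) e :
  (forall i, (tdeg (tnth lq i) <= e)%N) -> (tdeg (p \mPo lq) <= tdeg p * e)%N.
Proof.
move=> lqe; rewrite comp_mpolyEX big_seq; elim/big_ind: _ => [|q q' qB q'B|m mp].
- by rewrite -mpolyC0 tdegC.
- exact: tdegD.
apply: leq_trans (tdegZ _ _) _; rewrite comp_mpolyX.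
have mB : (mdeg m <= tdeg p)%N by move: m mp; apply/tdeg_leP.
apply: leq_trans (leq_mul mB (leqnn e)); rewrite mdegE big_distrl /=.
apply: tdeg_prod => i; apply: leq_trans (tdegX _ _) _.
by rewrite leq_mul2l lqe orbT.
Qed.

Section Feasible.
Context (F : fieldType) (W : nat) (W2 : (1 < W)%N).

(** The degree is recorded next to the size because it dictates the number of interpolation points,
    which in turn enters the size. *)
Definition feas (N : nat) (D b : nat) (p : {mpoly F[N]}) : Prop :=
  realizable [:: p] D (W ^ b) /\ (tdeg p <= W ^ b)%N.

Let leqW m k : (m <= k)%N -> (W ^ m <= W ^ k)%N.
Proof. by move=> mk; rewrite leq_exp2l. Qed.

Let W1 m : (0 < W ^ m)%N. Proof. by rewrite expn_gt0 ltnW. Qed.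

Section OneRing.
Context (N : nat).
Implicit Types (p q : {mpoly F[N]}).

Lemma feas_mono D b D' b' p :
  (D <= D')%N -> (b <= b')%N -> feas D b p -> feas D' b' p.
Proof.
move=> DD bb [pD pb]; split; first exact: realizable_mono (leqW bb) pD.
exact: leq_trans (leqW bb).
Qed.

Lemma feasC c D b : feas D b (c%:MP : {mpoly F[N]}).
Proof. by split; [exact: realizable_C|rewrite tdegC]. Qed.

Lemma feas0 D b : feas D b (0 : {mpoly F[N]}).
Proof. by rewrite -mpolyC0; apply: feasC. Qed.

Lemma feasX i D b : feas D b ('X_i : {mpoly F[N]}).
Proof. by split; [exact: realizable_X|rewrite tdegXU W1]. Qed.

Let nary_cost t c b : (t <= W ^ c)%N -> (t * W ^ b + t <= W ^ (c + b).+1)%N.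
Proof.
move=> tc; rewrite -mulnSr expnS expnD.
have := leq_mul tc (leqnn (W ^ b)).
have : (t * (W ^ b).+1 <= W ^ c * (W ^ b * 2))%N.
  by apply: leq_mul => //; have := W1 b; lia.
move: W2; nia.
Qed.

Lemma feas_sum (I : eqType) (r : seq I) (f : I -> {mpoly F[N]}) D b c :
  (size r <= W ^ c)%N -> (forall i, feas D b (f i)) ->
  feas D.+1 (c + b).+1 (\sum_(i <- r) f i).
Proof.
move=> rc fD; split; last first.
  by apply: tdeg_sum => i; apply: leq_trans (fD i).2 (leqW _); lia.
have := realizable_sum (realizable_map (r := r) (fun i _ => (fD i).1)).
rewrite big_map size_map => H; apply: realizable_mono H => //.
exact: nary_cost.
Qed.

Lemma feas_prod (I : eqType) (r : seq I) (f : I -> {mpoly F[N]}) D b c :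
  (size r <= W ^ c)%N -> (forall i, feas D b (f i)) ->
  feas D.+1 (c + b).+1 (\prod_(i <- r) f i).
Proof.
move=> rc fD; split.
  have := realizable_prod (realizable_map (r := r) (fun i _ => (fD i).1)).
  rewrite big_map size_map => H; apply: realizable_mono H => //.
  exact: nary_cost.
apply: leq_trans (tdeg_prod r (fun i => (fD i).2)) _.
rewrite big_const_seq count_predT iter_addn_0 mulnC.
by apply: leq_trans (nary_cost b rc); apply: leq_addr.
Qed.

Lemma feasM p q D b : feas D b p -> feas D b q -> feas D.+1 b.+2 (p * q).
Proof.
move=> pD qD.
have := @feas_prod bool [:: true; false] (fun x => if x then p else q)
  D b 1.
by rewrite !big_cons big_nil /= mulr1 expn1 add1n; apply=> // -[].
Qed.

Lemma feasD p q D b : feas D b p -> feas D b q -> feas D.+1 b.+2 (p + q).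
Proof.
move=> pD qD.
have := @feas_sum bool [:: true; false] (fun x => if x then p else q)
  D b 1.
by rewrite !big_cons big_nil /= addr0 expn1 add1n; apply=> // -[].
Qed.

Lemma feasZ c p D b : feas D b p -> feas D.+1 b.+2 (c *: p).
Proof. by move=> pD; rewrite -mul_mpolyC; apply: feasM => //; apply: feasC. Qed.

Lemma feas_lin (I : eqType) (r : seq I) a (f : I -> {mpoly F[N]}) D b c :
  (size r <= W ^ c)%N -> (forall i, feas D b (f i)) ->
  feas D.+2 (c + b).+3 (\sum_(i <- r) a i *: f i).
Proof.
move=> rc fD; rewrite -2!addnS; apply: feas_sum => // i; exact: feasZ.
Qed.

End OneRing.

Lemma feas_subst N N' p (lq : N.-tuple {mpoly F[N']}) D b D' b' :
  feas D b p -> (forall i, feas D' b' (tnth lq i)) ->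
  feas (D + D') (b + b').+2 (p \mPo lq).
Proof.
move=> [pD pb] lqD; split.
  apply: realizable_mono (realizable_subst pD (fun i => (lqD i).1)) => //.
  rewrite -addn2 expnD expnD.
  have : (4 <= W ^ 2)%N by rewrite (leq_exp2r 2 W (e := 2)).
  move: (W1 b) (W1 b'); set x := (W ^ b)%N; set y := (W ^ b')%N; set z := (W ^ 2)%N.
  move=> x0 y0 z4; have : (x * y * 4 <= x * y * z)%N by rewrite leq_mul2l z4 orbT.
  nia.
apply: leq_trans (tdeg_comp p (fun i => (lqD i).2)) _.
apply: leq_trans (leq_mul pb (leqnn _)) _; rewrite -expnD; apply: leqW; lia.
Qed.

End Feasible.

(** * Coefficient extraction by interpolation *)

Lemma pchar0_natr_inj (F : fieldType) : [pchar F] =i pred0 ->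
  injective (fun i : nat => i%:R : F).
Proof.
move=> char0; have /pcharf0P nat0 := char0.
suff H i j : (i <= j)%N -> (i%:R : F) = j%:R -> i = j.
  move=> i j ij; case: (leqP i j) => [/H|/ltnW /H H']; first exact.
  by rewrite H'.
move=> ij /eqP; rewrite eq_sym -subr_eq0 -natrB // nat0 subn_eq0 => ji.
by apply/eqP; rewrite eqn_leq ij.
Qed.

(** The weights are the entries of the inverse of the Vandermonde matrix at 0, ..., m - 1,
    invertible in characteristic zero. They lie in F and serve every F-algebra, so the same w
    extracts coefficients in T and in z. *)
Lemma interpolation (F : fieldType) (m : nat) : [pchar F] =i pred0 ->
  exists w : nat -> nat -> F,
  forall (R : comNzRingType) (iota : {rmorphism F -> R}) (f : {poly R}) e,
  (size f <= m)%N -> (e < m)%N ->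
  f`_e = \sum_(j < m) iota (w e j) * f.[iota j%:R].
Proof.
move=> char0.
pose V : 'M[F]_m := Vandermonde m (\row_(j < m) (j : nat)%:R).
have Vu : V \in unitmx.
  rewrite unitmxE det_Vandermonde unitfE; apply/prodf_neq0 => i _.
  apply/prodf_neq0 => j ij; rewrite !mxE subr_eq0.
  by apply: contraTneq ij => /(pchar0_natr_inj char0) ->; rewrite ltnn.
exists (fun e j => if insub e is Some e' then
  if insub j is Some j' then invmx V j' e' else 0 else 0).
move=> R iota f e fm em; rewrite insubT /=.
under eq_bigr => j _ do rewrite valK (horner_coef_wide _ fm) mulr_sumr.
rewrite exchange_big /= (bigD1 (Ordinal em)) //= [X in _ + X]big1 => [|i ie].
  rewrite addr0 -[LHS]mulr1.
  have /matrixP/(_ (Ordinal em) (Ordinal em)) := mulmxV Vu.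
  rewrite !mxE eqxx => /(congr1 iota); rewrite rmorph1 rmorph_sum /= => <-.
  rewrite mulr_sumr; apply: eq_bigr => j _.
  by rewrite !mxE rmorphM /= rmorphXn /= mulrCA mulrC mulrCA mulrA mulrC.
have /matrixP/(_ i (Ordinal em)) := mulmxV Vu.
rewrite !mxE (negPf ie) => /(congr1 iota); rewrite rmorph0 rmorph_sum /=.
move=> H; rewrite -[RHS](mulr0 f`_i) -[X in _ = _ * X]H mulr_sumr; apply: eq_bigr => j _.
by rewrite !mxE rmorphM /= rmorphXn /= mulrCA; congr (_ * _); rewrite mulrC.
Qed.

Section Boxes.
Context (A : comNzRingType).
Implicit Types (f g : {poly {poly A}}).

Definition box (B : nat) f : Prop :=
  (size f <= B.+1)%N /\ forall j, (size (f`_j)%R <= B.+1)%N.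

Lemma box_mono B B' f : (B <= B')%N -> box B f -> box B' f.
Proof. by move=> BB [sf sc]; split=> [|j]; apply: (@leq_trans B.+1). Qed.

Lemma box_const a B : box B a%:P%:P.
Proof.
split=> [|j]; first by rewrite (leq_trans (size_polyC_leq1 _)).
by rewrite coefC; case: eqP => _; rewrite ?size_poly0 // (leq_trans (size_polyC_leq1 _)).
Qed.

Lemma boxX B : box B.+1 'X.
Proof.
split=> [|j]; first by rewrite size_polyX.
by rewrite coefX; case: eqP => _; rewrite ?size_poly0 // size_poly1.
Qed.

Lemma boxXC B : box B.+1 'X%:P.
Proof.
split=> [|j]; first by rewrite (leq_trans (size_polyC_leq1 _)).
by rewrite coefC; case: eqP => _; rewrite ?size_poly0 // size_polyX.
Qed.

Lemma boxD B f g : box B f -> box B g -> box B (f + g).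
Proof.
move=> [sf cf] [sg cg]; split=> [|j].
  by apply: leq_trans (size_polyD _ _) _; rewrite geq_max sf.
by rewrite coefD; apply: leq_trans (size_polyD _ _) _; rewrite geq_max cf cg.
Qed.

Lemma box_sum (I : Type) (r : seq I) (f : I -> {poly {poly A}}) B :
  (forall i, box B (f i)) -> box B (\sum_(i <- r) f i).
Proof.
move=> fB; elim/big_ind: _ => [|p q|//]; last exact: boxD.
exact: (box_const 0).
Qed.

Lemma size_sum_leq (R : nzRingType) (I : Type) (r : seq I) (p : I -> {poly R}) B :
  (forall i, (size (p i) <= B)%N) -> (size (\sum_(i <- r) p i)%R <= B)%N.
Proof.
move=> pB; elim/big_ind: _ => [|p1 p2 s1 s2|//]; first by rewrite size_poly0.
by apply: leq_trans (size_polyD _ _) _; rewrite geq_max s1.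
Qed.

Lemma boxM B B' f g : box B f -> box B' g -> box (B + B') (f * g).
Proof.
move=> [sf cf] [sg cg]; split=> [|j].
  apply: leq_trans (size_polyMleq _ _) _.
  by move: (size f) (size g) sf sg => a b; lia.
rewrite coefM; apply: size_sum_leq => i.
apply: leq_trans (size_polyMleq _ _) _.
by move: (size _) (size _) (cf i) (cg (j - i)%N) => a b; lia.
Qed.

Lemma box_prod (I : Type) (r : seq I) (f : I -> {poly {poly A}}) B :
  (forall i, box B (f i)) -> box (size r * B) (\prod_(i <- r) f i).
Proof.
move=> fB; elim: r => [|i r IH]; first by rewrite big_nil; apply: (box_const 1).
by rewrite big_cons mulSn; apply: boxM.
Qed.

Lemma box_coef j B f : box B f -> box B (f`_j)%:P.
Proof.
case=> _ cf; split=> [|i]; first by rewrite (leq_trans (size_polyC_leq1 _)).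
by rewrite coefC; case: eqP => _ //; rewrite size_poly0.
Qed.

Lemma box_deriv B f : box B f -> box B f^`().
Proof.
case=> sf cf; split=> [|j]; last first.
  rewrite coef_deriv; apply: leq_trans (cf j.+1).
  by apply/leq_sizeP => i ij; rewrite coefMn nth_default // mul0rn.
by apply: leq_trans sf; apply: leq_trans (size_poly _ _) _; rewrite leq_pred.
Qed.

End Boxes.

Lemma size_index_enum (I : finType) : size (index_enum I) = #|I|.
Proof. by rewrite -sum1_card big_const_seq count_predT iter_addn_0 mul1n. Qed.

Section BivariateFeasible.
Context (F : fieldType) (char0 : [pchar F] =i pred0) (W : nat) (W2 : (1 < W)%N).
Context (n : nat).
Let A : comNzRingType := {mpoly F[n]}.
Implicit Types (f g : {poly {poly A}}).

Let leqW m k : (m <= k)%N -> (W ^ m <= W ^ k)%N.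
Proof. by move=> mk; rewrite leq_exp2l. Qed.

Let W1 m : (0 < W ^ m)%N. Proof. by rewrite expn_gt0 ltnW. Qed.

Let ltW m : (W ^ m < W ^ m.+1)%N.
Proof. by rewrite expnS; move: (W1 m) W2; nia. Qed.

Definition scalar2 (c : F) : {poly {poly A}} := (c%:MP : A)%:P%:P.

Definition eval2 (c c' : F) f : A := f.[(c'%:MP : A)%:P].[c%:MP].

(** An element of F[x][T][z] is held through its coefficients, each with its own circuit: taking a
    coefficient is then free, and products go through values at scalars. *)
Definition bfeas (D b : nat) f : Prop :=
  box (W ^ b) f /\ forall i j, feas W D b (f`_j`_i : {mpoly F[n]}).

Lemma bfeas_mono D b D' b' f :
  (D <= D')%N -> (b <= b')%N -> bfeas D b f -> bfeas D' b' f.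
Proof.
move=> DD bb [fB fD]; split=> [|i j]; first exact: box_mono (leqW bb) fB.
exact: feas_mono (fD i j).
Qed.

Lemma bfeas_eval D b f c c' : bfeas D b f -> feas W D.+2 (3 * b + 5) (eval2 c c' f).
Proof.
move=> [[sf cf] fD].
have -> : eval2 c c' f = \sum_(ij : 'I_(W ^ b).+1 * 'I_(W ^ b).+1)
    (c ^+ ij.1 * c' ^+ ij.2) *: (f`_(ij.2)`_(ij.1)).
  rewrite /eval2 (horner_coef_wide _ sf) -(pair_bigA _ (fun i j : 'I__ =>
     (c ^+ i * c' ^+ j) *: f`_j`_i)) exchange_big /=.
  rewrite horner_sum; apply: eq_bigr => j _.
  rewrite -polyC_exp hornerM hornerC (horner_coef_wide _ (cf j)) mulr_suml.
  apply: eq_bigr => i _; rewrite -mul_mpolyC rmorphM /= !rmorphXn /=.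
  by rewrite [RHS]mulrC mulrA.
have -> : (3 * b + 5 = ((b.+1 + b.+1) + b).+3)%N by lia.
apply: feas_lin => //.
by rewrite size_index_enum card_prod card_ord expnD leq_mul ?ltW.
Qed.

Lemma bfeas_interp D b f : box (W ^ b) f ->
  (forall c c', feas W D b (eval2 c c' f)) -> bfeas D.+2 (3 * b + 5) f.
Proof.
move=> fB fD; split=> [|i j]; first by apply: box_mono fB; apply: leqW; lia.
case: fB => sf cf.
have [w wP] := interpolation (W ^ b).+1 char0.
case: (ltnP j (W ^ b).+1) => jB; last first.
  by rewrite [f`_j]nth_default ?coef0; [exact: feas0|exact: leq_trans sf jB].
case: (ltnP i (W ^ b).+1) => iB; last first.
  by rewrite nth_default; [exact: feas0|exact: leq_trans (cf j) iB].
have -> : f`_j`_i = \sum_(ij : 'I_(W ^ b).+1 * 'I_(W ^ b).+1)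
    (w i ij.1 * w j ij.2) *: eval2 (ij.1)%:R (ij.2)%:R f.
  rewrite (wP _ (@mpolyC n F) _ _ (cf j) iB) -(pair_bigA _ (fun a b : 'I__ =>
     (w i a * w j b) *: eval2 a%:R b%:R f)) /=.
  apply: eq_bigr => a _.
  rewrite (wP _ (polyC \o @mpolyC n F) _ _ sf jB) horner_sum mulr_sumr.
  apply: eq_bigr => b' _.
  by rewrite hornerM hornerC -mul_mpolyC rmorphM /= mulrA.
have -> : (3 * b + 5 = ((b.+1 + b.+1) + b).+3)%N by lia.
apply: feas_lin => //.
by rewrite size_index_enum card_prod card_ord expnD leq_mul ?ltW.
Qed.

Lemma bfeas_sum (I : eqType) (r : seq I) (f : I -> {poly {poly A}}) D b c :
  (size r <= W ^ c)%N -> (forall i, bfeas D b (f i)) ->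
  bfeas D.+1 (c + b).+1 (\sum_(i <- r) f i).
Proof.
move=> rc fD; split=> [|i j].
  by apply: box_sum => k; apply: box_mono (fD k).1; apply: leqW; lia.
by rewrite !coef_sum; apply: feas_sum => // k; case: (fD k).
Qed.

(** Multiplying in one factor after another would take a depth that grows with their number. Instead
    the factors are evaluated at scalars, the values are multiplied by one gate, and the
    coefficients are interpolated: 2 + 1 + 2 levels. *)
Lemma bfeas_prod (I : eqType) (r : seq I) (f : I -> {poly {poly A}}) D b c :
  (size r <= W ^ c)%N -> (forall i, bfeas D b (f i)) ->
  bfeas (D + 5) (9 * b + 3 * c + 23) (\prod_(i <- r) f i).
Proof.
move=> rc fD.
have -> : (9 * b + 3 * c + 23 = 3 * (c + (3 * b + 5)).+1 + 5)%N by lia.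
have -> : (D + 5 = D.+3.+2)%N by lia.
apply: bfeas_interp.
  apply: box_mono (box_prod r (fun i => (fD i).1)).
  apply: leq_trans (leq_mul rc (leqnn _)) _; rewrite -expnD; apply: leqW; lia.
move=> c1 c2; rewrite /eval2 !horner_prod.
by apply: feas_prod => // i; apply: bfeas_eval.
Qed.

Lemma bfeasM f g D b : bfeas D b f -> bfeas D b g ->
  bfeas (D + 5) (9 * b + 26) (f * g).
Proof.
move=> fD gD.
have := @bfeas_prod bool [:: true; false] (fun x => if x then f else g) D b 1.
rewrite !big_cons big_nil /= mulr1 expn1 muln1 -addnA; apply=> //.
by case.
Qed.

Lemma bfeasX_exp f m c D b : (m <= W ^ c)%N -> bfeas D b f ->
  bfeas (D + 5) (9 * b + 3 * c + 23) (f ^+ m).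
Proof.
move=> mc fD; have := @bfeas_prod _ (nseq m tt) (fun=> f) D b c.
by rewrite size_nseq big_nseq -Monoid.iteropE; apply.
Qed.

Lemma bfeasD f g D b : bfeas D b f -> bfeas D b g -> bfeas D.+1 b.+2 (f + g).
Proof.
move=> [fB fD] [gB gD]; split=> [|i j].
  by apply: boxD; [apply: box_mono fB|apply: box_mono gB]; apply: leqW; lia.
by rewrite !coefD; apply: feasD.
Qed.

Lemma bfeasZ c f D b : bfeas D b f -> bfeas D.+1 b.+2 (scalar2 c * f).
Proof.
move=> [fB fD]; split=> [|i j].
  rewrite -[(W ^ _)%N]add0n; apply: boxM; first exact: box_const.
  by apply: box_mono fB; apply: leqW; lia.
by rewrite !coefCM mul_mpolyC; apply: feasZ.
Qed.

Lemma bfeas_deriv f D b : bfeas D b f -> bfeas D.+1 b.+2 f^`().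
Proof.
move=> [fB fD]; split=> [|i j].
  by apply/box_deriv/(box_mono _ fB)/leqW; lia.
by rewrite coef_deriv coefMn -scaler_nat; apply: feasZ.
Qed.

Lemma bfeas_coef f j D b : bfeas D b f -> bfeas D b (f`_j)%:P.
Proof.
move=> [fB fD]; split=> [|i k]; first exact: box_coef.
by rewrite coefC; case: eqP => _ //; rewrite coef0; apply: feas0.
Qed.

Lemma bfeas_const a D b : feas W D b (a : {mpoly F[n]}) -> bfeas D b a%:P%:P.
Proof.
move=> aD; split=> [|i j]; first exact: box_const.
rewrite coefC; case: eqP => _; last by rewrite coef0; apply: feas0.
by rewrite coefC; case: eqP => _ //; apply: feas0.
Qed.

Lemma bfeas_scalar c D b : bfeas D b (scalar2 c).
Proof. by apply: bfeas_const; apply: feasC. Qed.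

Lemma bfeasX D b : bfeas D b 'X.
Proof.
split=> [|i j]; first by rewrite -(prednK (W1 b)); apply: boxX.
rewrite coefX; case: eqP => _ /=; last by rewrite coef0; apply: feas0.
by rewrite coef1; case: (i == 0)%N; [rewrite -mpolyC1; apply: feasC|exact: feas0].
Qed.

End BivariateFeasible.

(** * Lagrange inversion for a simple root *)

Section Congruences.
Context (B : comNzRingType) (t : B).
Implicit Types (x y z : B).

Definition mult_of x : Prop := exists h, x = t * h.
Definition cong x y : Prop := mult_of (x - y).

Lemma mult_of0 : mult_of 0. Proof. by exists 0; rewrite mulr0. Qed.

Lemma mult_ofD x y : mult_of x -> mult_of y -> mult_of (x + y).
Proof. by move=> [a ->] [b ->]; exists (a + b); rewrite mulrDr. Qed.

Lemma mult_ofN x : mult_of x -> mult_of (- x).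
Proof. by move=> [a ->]; exists (- a); rewrite mulrN. Qed.

Lemma mult_ofM x y : mult_of y -> mult_of (x * y).
Proof. by move=> [a ->]; exists (x * a); rewrite mulrCA. Qed.

Lemma mult_of_self x : mult_of (t * x).
Proof. by exists x. Qed.

Lemma cong_refl x : cong x x.
Proof. by rewrite /cong subrr; apply: mult_of0. Qed.

Lemma cong_sym x y : cong x y -> cong y x.
Proof. by move/mult_ofN; rewrite opprB. Qed.

Lemma cong_trans y x z : cong x y -> cong y z -> cong x z.
Proof. by move=> xy /(mult_ofD xy); rewrite addrA subrK. Qed.

Lemma congD x x' y y' : cong x x' -> cong y y' -> cong (x + y) (x' + y').
Proof. by move=> xx /(mult_ofD xx); rewrite addrACA -opprD. Qed.

Lemma congN x x' : cong x x' -> cong (- x) (- x').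
Proof. by move/mult_ofN; rewrite opprD. Qed.

Lemma congB x x' y y' : cong x x' -> cong y y' -> cong (x - y) (x' - y').
Proof. by move=> xx /congN; apply: congD. Qed.

Lemma congM x x' y y' : cong x x' -> cong y y' -> cong (x * y) (x' * y').
Proof.
move=> xx yy; rewrite /cong.
have -> : x * y - x' * y' = y * (x - x') + x' * (y - y') by ring.
by apply: mult_ofD; apply: mult_ofM.
Qed.

Lemma congX x x' m : cong x x' -> cong (x ^+ m) (x' ^+ m).
Proof.
move=> xx; elim: m => [|m IH]; first exact: cong_refl.
by rewrite !exprS; apply: congM.
Qed.

Lemma cong_sum (I : Type) (r : seq I) (P : pred I) (f g : I -> B) :
  (forall i, P i -> cong (f i) (g i)) ->
  cong (\sum_(i <- r | P i) f i) (\sum_(i <- r | P i) g i).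
Proof. by move=> fg; elim/big_ind2: _ => //; [exact: cong_refl|move=> *; exact: congD]. Qed.

Lemma cong_prod (I : Type) (r : seq I) (P : pred I) (f g : I -> B) :
  (forall i, P i -> cong (f i) (g i)) ->
  cong (\prod_(i <- r | P i) f i) (\prod_(i <- r | P i) g i).
Proof. by move=> fg; elim/big_ind2: _ => //; [exact: cong_refl|move=> *; exact: congM]. Qed.

Lemma cong_horner (f : {poly B}) x y : cong x y -> cong f.[x] f.[y].
Proof.
move=> xy; rewrite !horner_coef; apply: cong_sum => i _.
by apply: congM; [exact: cong_refl|exact: congX].
Qed.

End Congruences.

Section RootFormula.
Context (B : comNzRingType) (tau : B) (M : nat) (M1 : (0 < M)%N).
Context (f : {poly B}) (y0 al be : B).
Context (albe : al * be = 1) (f0 : mult_of tau f`_0) (f1 : cong tau f`_1 al).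
Context (y0tau : mult_of tau y0) (fy0 : mult_of (tau ^+ M) f.[y0]).

Local Notation L := (3 * M)%N.
Local Notation E := (4 * M + 2)%N.
Let T := tau ^+ M.

Definition root_tail : {poly B} := al%:P * 'X - f.

(** The quotient ((al y)^L - N^L) / f with N = [root_tail], that is, (al y)^L / f with the geometric
    series cut after L terms. *)
Definition root_kernel : {poly B} :=
  \sum_(m < L) (al%:P * 'X) ^+ (L.-1 - m) * root_tail ^+ m.

Let tail_split : exists N0 N1 : {poly B},
  root_tail = tau%:P * N0 + 'X^2 * N1.
Proof.
have [a fa] := f0; have [b fb] := f1.
exists ((- a)%:P + (- b)%:P * 'X), (- drop_poly 2 f).
rewrite /root_tail -[X in _ - X](poly_take_drop 2) /take_poly.
have -> : \poly_(i < 2) f`_i = (tau * a)%:P + (al + tau * b)%:P * 'X.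
  have -> : al + tau * b = f`_1 by rewrite -fb addrC subrK.
  apply/polyP => i; rewrite coef_poly coefD coefCM coefX coefC.
  by case: i => [|[|i]] //=; rewrite ?fa ?mulr0 ?mulr1 ?addr0 ?add0r.
rewrite !polyCN !polyCD !polyCM -commr_polyXn; ring.
Qed.

(** Source of L = 3 M and E = 4 M + 2: in the binomial expansion of (tau N0 + y^2 N1)^L, the term of
    index i either has L - i >= M, hence a factor tau^M, or has i > 2 M, hence a factor y^E. *)
Let tail_pow : exists U V : {poly B}, root_tail ^+ L = T%:P * U + 'X^E * V.
Proof.
have [N0 [N1 ->]] := tail_split.
rewrite exprDn.
pose F i := (tau%:P * N0) ^+ (L - i) * ('X^2 * N1) ^+ i *+ 'C(L, i).
suff H (r : seq nat) : {in r, forall i, (i <= L)%N} ->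
    exists U V : {poly B}, \sum_(i <- r) F i = T%:P * U + 'X^E * V.
  rewrite -(big_mkord xpredT F); apply: H => i; rewrite mem_index_iota; lia.
elim: r => [|i r IH] ri.
  by exists 0, 0; rewrite big_nil !mulr0 addr0.
have [|U [V UV]] := IH; first by move=> j jr; apply: ri; rewrite inE jr orbT.
have iL := ri i (mem_head _ _).
rewrite big_cons UV /F; case: (leqP M (L - i)) => iM.
  exists (U + tau%:P ^+ (L - i - M) * N0 ^+ (L - i) * ('X^2 * N1) ^+ i *+ 'C(L, i)), V.
  rewrite exprMn -{1}(subnK iM) exprD -mulr_natr -[X in U + X]mulr_natr /T polyC_exp.
  ring.
exists U, (V + (tau%:P * N0) ^+ (L - i) * 'X^(2 * i - E) * N1 ^+ i *+ 'C(L, i)).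
have iE : (2 * i = (2 * i - E) + E)%N by lia.
rewrite [('X^2 * N1) ^+ _]exprMn -exprM {1}iE exprD -mulr_natr -[X in V + X]mulr_natr.
ring.
Qed.

Let I : B -> Prop := mult_of T.

(* f S = (al y)^L - (al y - f)^L with S = root_kernel, and the second power
   vanishes modulo (tau^M, y^E).  This is the Lagrange inversion formula
   y0 = res (y f' / f) with 1 / f expanded as a geometric series in f - al y. *)
Lemma root_formula : cong T (f^`() * root_kernel)`_(L - 2) (al ^+ L * y0).
Proof.
have [c fc] := fy0.
have /factor_theorem[q fq] : root (f - f.[y0]%:P) y0.
  by rewrite rootE hornerD hornerN hornerC subrr.
have {}fq : f = q * ('X - y0%:P) + f.[y0]%:P by rewrite -fq subrK.
have [U [V UV]] := tail_pow.
set S := root_kernel.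
have fS : f * S = (al ^+ L)%:P * 'X^L - T%:P * U - 'X^E * V.
  rewrite -addrA -opprD -UV polyC_exp -exprMn subrXX_comm; last exact: mulrC.
  by rewrite /S /root_kernel {1}/root_tail opprB addrCA subrr addr0 -subn1.
have {}fS : ('X - y0%:P) * (q * S)
    = (al ^+ L)%:P * 'X^L - T%:P * (U + c%:P * S) - 'X^E * V.
  have -> : ('X - y0%:P) * (q * S) = f * S - f.[y0]%:P * S.
    by rewrite {1}fq; ring.
  by rewrite fS fc polyCM; ring.
(* Modulo tau^M and y^E, u behaves like al^L y^L / (y - y0). Its coefficient at L is congruent to a
   multiple of y0^M, hence to 0; from there the recurrence [uS], read downwards, gives al^L at L - 1
   and al^L y0 at L - 2. *)
set u := q * S in fS.
have Icoef (p : {poly B}) e : I (T%:P * p)`_e by rewrite coefCM; exists p`_e.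
have uE e : (e < E)%N -> I ((('X - y0%:P) * u)`_e - al ^+ L *+ (e == L)).
  move=> eE; rewrite fS !coefB coefCM coefXn coefXnM eE subr0 mulr_natr addrAC.
  rewrite subrr add0r; exact/mult_ofN/Icoef.
have uS e : (e.+1 < E)%N -> cong T u`_e (al ^+ L *+ (e.+1 == L) + y0 * u`_e.+1).
  move=> /uE; rewrite mulrBl coefB coefXM coefCM /=.
  by rewrite /cong opprD addrCA addrC.
have uk k : (L + k < E)%N -> cong T u`_L (y0 ^+ k * u`_(L + k)).
  elim: k => [|k IH] kE; first by rewrite addn0 expr0 mul1r; apply: cong_refl.
  apply: (@cong_trans _ _ (y0 ^+ k * u`_(L + k))); first by apply: IH; lia.
  rewrite exprSr -mulrA; apply: congM; first exact: cong_refl.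
  have := uS (L + k)%N; rewrite -[(L + k).+1]addnS => /(_ kE).
  have -> : (L + k.+1 == L)%N = false by lia.
  by rewrite mulr0n add0r.
have uL : I u`_L.
  have [y1 y1E] := y0tau.
  have := uk M; have -> : y0 ^+ M = T * y1 ^+ M by rewrite y1E exprMn.
  case; first by lia.
  by move=> h /eqP; rewrite subr_eq -mulrA -mulrDr => /eqP ->; apply: mult_of_self.
have uL1 : cong T u`_(L - 1) (al ^+ L).
  apply: cong_trans (uS _ _) _; first by lia.
  have -> : (L - 1).+1 = L by lia.
  by rewrite eqxx mulr1n /cong addrAC subrr add0r; apply: mult_ofM.
have uL2 : cong T u`_(L - 2) (al ^+ L * y0).
  apply: cong_trans (uS _ _) _; first by lia.
  have -> : (L - 2).+1 = (L - 1)%N by lia.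
  have -> : (L - 1 == L)%N = false by lia.
  by rewrite mulr0n add0r mulrC; apply: congM => //; apply: cong_refl.
(* The rest of f' S contributes nothing below y^L: q v does not, and the constant term of q is the
   unit al modulo tau, so the coefficients of v vanish modulo tau^M one after the other. *)
pose v := ('X - y0%:P) * q^`() * S.
have fu : f^`() * S = u + v.
  rewrite fq derivD derivC addr0 derivM derivB derivX derivC subr0 /u /v.
  ring.
have qv e : (e < L)%N -> I (q * v)`_e.
  move=> eL.
  have -> : q * v = q^`() * (('X - y0%:P) * u) by rewrite /v /u; ring.
  rewrite fS mulrBr mulrBr.
  have -> : q^`() * ((al ^+ L)%:P * 'X^L) = 'X^L * (q^`() * (al ^+ L)%:P) by ring.
  rewrite !coefB [q^`() * ('X^E * V)]mulrCA [q^`() * (T%:P * _)]mulrCA !coefXnM eL.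
  have -> : (e < E)%N by lia.
  by rewrite subr0 sub0r; apply/mult_ofN/Icoef.
have [ep q0] : mult_of tau (q`_0 - al).
  have -> : q`_0 - al = (f`_1 - al) + y0 * q`_1.
    rewrite {1}fq coefD coefC mulrBr coefB coefMX coefMC /=; ring.
  by apply: mult_ofD => //; rewrite mulrC; apply: mult_ofM.
have vI e : (e < L)%N -> I v`_e.
  elim/ltn_ind: e => e IH eL.
  have Iq : I (q`_0 * v`_e).
    have := qv e eL; rewrite coefM big_ord_recl /= subn0 => H.
    have -> : q`_0 * v`_e = q`_0 * v`_e + \sum_(i < e) q`_(bump 0 i) * v`_(e - bump 0 i)
        - \sum_(i < e) q`_(bump 0 i) * v`_(e - bump 0 i) by rewrite addrK.
    apply: mult_ofD H _; apply: mult_ofN.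
    elim/big_ind: _ => [|x y|i _]; [exact: mult_of0|exact: mult_ofD|].
    by apply: mult_ofM; apply: IH; rewrite /bump leq0n /=; have := ltn_ord i; lia.
  have vE : v`_e = be * (q`_0 * v`_e) - be * ep * tau * v`_e.
    have -> : q`_0 = al + tau * ep by rewrite -q0; ring.
    transitivity (al * be * v`_e); first by rewrite albe mul1r.
    ring.
  have vk k : cong T v`_e ((- (be * ep)) ^+ k * tau ^+ k * v`_e).
    elim: k => [|k IHk]; first by rewrite !expr0 !mul1r; apply: cong_refl.
    apply: cong_trans IHk _; rewrite /cong.
    have -> : (- (be * ep)) ^+ k * tau ^+ k * v`_e
        - (- (be * ep)) ^+ k.+1 * tau ^+ k.+1 * v`_e
      = (- (be * ep)) ^+ k * tau ^+ k * be * (q`_0 * v`_e).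
      by rewrite {1}vE !exprS; ring.
    exact: mult_ofM.
  have [h /eqP] := vk M; rewrite subr_eq => /eqP ->.
  by exists (h + (- (be * ep)) ^+ M * v`_e); rewrite /T; ring.
by rewrite fu coefD /cong addrAC; apply: mult_ofD => //; apply: vI; lia.
Qed.

End RootFormula.

Section RootCircuit.
Context (F : fieldType) (char0 : [pchar F] =i pred0) (W : nat) (W2 : (1 < W)%N).
Context (n : nat).
Let A : comNzRingType := {mpoly F[n]}.

Lemma scalar2N1 (f : {poly {poly A}}) : scalar2 n (-1) * f = - f.
Proof.
have H : ((-1 : F)%:MP : A) = -1 by rewrite mpolyCN mpolyC1.
rewrite /scalar2 H (_ : (-1)%:P%:P = -1 :> {poly {poly A}}) ?mulN1r //.
by rewrite !raddfN.
Qed.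

(** Y depends on f alone and represents any root that vanishes at T = 0. The 19 levels are 2 for
    [root_tail], 5 for powers, 5 for a product of two powers, 1 for the sum, 5 for the factor f' and
    1 for the scalar al^-L. *)
Lemma root_circuit (f : {poly {poly A}}) (al : F) (M c D b : nat) :
  bfeas W D b f -> (0 < M)%N -> (M <= W ^ c)%N -> al != 0 ->
  mult_of 'X f`_0 -> cong 'X f`_1 (al%:MP : A)%:P ->
  exists2 Y : {poly A}, bfeas W (D + 19) (729 * (b + 8) + 252 * c) Y%:P &
  forall y0, mult_of 'X y0 -> mult_of 'X^M f.[y0] -> cong 'X^M Y y0.
Proof.
move=> fD M1 Mc al0 f0 f1; set L := (3 * M)%N.
have Lc : (L <= W ^ c.+2)%N.
  have W4 : (4 <= W * W)%N by nia.
  rewrite !expnS mulnA; apply: leq_trans (leq_mul W4 Mc); rewrite /L; lia.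
pose alP := (al%:MP : A)%:P; pose beP := (al^-1%:MP : A)%:P.
have albe : alP * beP = 1 by rewrite -polyCM -mpolyCM mulfV.
pose G := f^`() * root_kernel M f alP.
exists (beP ^+ L * G`_(L - 2)); last first.
  move=> y0 y0X fy0.
  have := root_formula M1 albe f0 f1 y0X fy0.
  move/(congM (cong_refl _ (beP ^+ L))); rewrite mulrA -exprMn mulrC -/G.
  by rewrite [beP * alP]mulrC albe expr1n mul1r mulrC.
have -> : (beP ^+ L * G`_(L - 2))%:P = scalar2 n (al^-1 ^+ L) * (G`_(L - 2))%:P.
  by rewrite polyCM /scalar2 !rmorphXn.
have XD : bfeas W D.+2 (b + 4) (alP%:P * 'X : {poly {poly A}}).
  rewrite -[alP%:P]/(scalar2 n al).
  by apply: (bfeas_mono W2 _ _ (bfeasZ W2 al (bfeasX F W2 n D 0))); lia.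
have NfD : bfeas W D.+2 (b + 4) (root_tail f alP).
  rewrite /root_tail addn4; apply: bfeasD => //.
    rewrite -[alP%:P]/(scalar2 n al).
    by apply: (bfeas_mono W2 _ _ (bfeasZ W2 al (bfeasX F W2 n D 0))); lia.
  by rewrite -scalar2N1; apply: bfeasZ.
have powD (g : {poly {poly A}}) k : (k <= L)%N ->
    bfeas W D.+2 (b + 4) g -> bfeas W (D.+2 + 5) (9 * b + 3 * c + 65) (g ^+ k).
  move=> kL gD; have -> : (9 * b + 3 * c + 65 = 9 * (b + 4) + 3 * c.+2 + 23)%N by lia.
  by apply: bfeasX_exp => //; apply: leq_trans Lc.
have SD : bfeas W (D + 13) (81 * b + 28 * c + 614) (root_kernel M f alP).
  apply: (@bfeas_mono _ _ W2 _ (D.+2 + 5 + 5).+1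
     (c.+2 + (9 * (9 * b + 3 * c + 65) + 26)).+1); try lia.
  rewrite /root_kernel; apply: bfeas_sum => // [|m].
    by rewrite size_index_enum card_ord.
  apply: bfeasM => //; apply: powD => //; have := ltn_ord m; lia.
apply: (@bfeas_mono _ _ W2 _ (D + 13 + 5).+1
     (9 * (81 * b + 28 * c + 614) + 26).+2); try lia.
apply: bfeasZ => //; apply: bfeas_coef; apply: bfeasM => //.
by apply: (bfeas_mono W2 _ _ (bfeas_deriv W2 fD)); lia.
Qed.

End RootCircuit.

(** * Hensel lifting and division by lifted roots *)

Section Hensel.
Context (B : comNzRingType) (tau : B).
Implicit Types (f p q : {poly B}) (x y : B).

Definition unit_mod x : Prop := exists y, cong tau (x * y) 1.

Lemma cong_pow_weaken m k x y : (k <= m)%N ->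
  cong (tau ^+ m) x y -> cong (tau ^+ k) x y.
Proof.
move=> km [h E]; exists (tau ^+ (m - k) * h).
by rewrite mulrA -exprD subnKC.
Qed.

(** If x z = 1 + tau h, then y = z (x y) - tau h y; each iteration gains a factor tau. *)
Lemma unit_mod_cancel M x y :
  unit_mod x -> mult_of (tau ^+ M) (x * y) -> mult_of (tau ^+ M) y.
Proof.
move=> [z [h xz]] xy.
have yE : y = z * (x * y) - tau * h * y by rewrite -xz; ring.
suff H k : cong (tau ^+ M) y ((- (tau * h)) ^+ k * y).
  have [g /eqP] := H M; rewrite subr_eq => /eqP ->.
  exists (g + (- h) ^+ M * y); rewrite -mulrN exprMn; ring.
elim: k => [|k IH]; first by rewrite expr0 mul1r; apply: cong_refl.
apply: cong_trans IH _; rewrite /cong.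
have -> : (- (tau * h)) ^+ k * y - (- (tau * h)) ^+ k.+1 * y
    = (- (tau * h)) ^+ k * z * (x * y) by rewrite {1}yE exprS; ring.
exact: mult_ofM.
Qed.

Lemma horner_taylor1 f x y :
  exists h, f.[x + y] = f.[x] + f^`().[x] * y + h * y ^+ 2.
Proof.
elim/poly_ind: f => [|f c [h IH]].
  by exists 0; rewrite deriv0 !horner0 !mul0r !addr0.
exists (h * (x + y) + f^`().[x]); rewrite derivMXaddC.
rewrite !(hornerD, hornerM, hornerX, hornerC) IH; ring.
Qed.

(** Newton iteration with a fixed approximate inverse be of the derivative: as be inverts it modulo
    tau only, each step gains one power of tau. *)
Lemma hensel f R al be k M : (0 < k)%N -> (k <= M)%N ->
  al * be = 1 -> cong tau f^`().[R] al -> mult_of (tau ^+ k) f.[R] ->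
  exists2 R', cong (tau ^+ k) R' R & mult_of (tau ^+ M) f.[R'].
Proof.
move=> k0 /subnKC <- albe fR' fR; elim: (M - k)%N => [|m [R1 R1R [h fR1]]].
  by exists R; [exact: cong_refl|rewrite addn0].
set e := (k + m)%N in fR1 *; have e0 : (0 < e)%N by rewrite addn_gt0 k0.
exists (R1 - be * h * tau ^+ e).
  apply: cong_trans R1R; rewrite /cong addrAC subrr add0r.
  by apply/mult_ofN/mult_ofM; rewrite /e exprD; apply: mult_of_self.
have [g ->] := horner_taylor1 f R1 (- (be * h * tau ^+ e)).
have [d dE] : cong tau f^`().[R1] al.
  apply: cong_trans fR'; apply: cong_horner.
  by have := cong_pow_weaken k0 R1R; rewrite expr1.
have -> : f^`().[R1] = al + tau * d by rewrite -dE; ring.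
rewrite fR1 addnS -/e; exists (- d * be * h + g * (be * h) ^+ 2 * tau ^+ (e.-1)).
have eE : tau ^+ e * tau ^+ e = tau ^+ e.+1 * tau ^+ e.-1.
  by rewrite -!exprD; congr (_ ^+ _); lia.
transitivity (tau ^+ e * h * (1 - al * be) - tau ^+ e * tau * d * be * h
    + g * (be * h) ^+ 2 * (tau ^+ e * tau ^+ e)); first by ring.
rewrite albe eE ![tau ^+ e.+1]exprS.
by move: (tau ^+ e) (tau ^+ e.-1) => s t; ring.
Qed.

Definition cong_poly (t : B) p q : Prop := forall j, cong t p`_j q`_j.

(** Induction on l: if q is the quotient of p - p(R l) by the linear factor at R l, then (R i - R l)
    q(R i) = p(R i) - p(R l), and the difference R i - R l can be cancelled. *)
Lemma vanish_distinct M l (R : nat -> B) p : (size p <= l)%N ->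
  (forall i, (i < l)%N -> mult_of (tau ^+ M) p.[R i]) ->
  (forall i j, (i < l)%N -> (j < l)%N -> i != j -> unit_mod (R i - R j)) ->
  forall j, mult_of (tau ^+ M) p`_j.
Proof.
elim: l p => [|l IH] p sp pR RU j.
  by move: sp; rewrite leqn0 size_poly_eq0 => /eqP ->; rewrite coef0; apply: mult_of0.
have /factor_theorem[q pq] : root (p - p.[R l]%:P) (R l).
  by rewrite rootE hornerD hornerN hornerC subrr.
have {}pq : p = q * ('X - (R l)%:P) + p.[R l]%:P by rewrite -pq subrK.
have sq : (size q <= l)%N.
  rewrite -ltnS; have [->|q0] := eqVneq q 0; first by rewrite size_poly0.
  have := size_Mmonic q0 (monicXsubC (R l)); rewrite size_XsubC addn2 /= => <-.
  have -> : q * ('X - (R l)%:P) = p - p.[R l]%:P by rewrite [X in _ = X - _]pq addrK.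
  apply: leq_trans (size_polyD _ _) _; rewrite geq_max sp size_polyN.
  exact: leq_trans (size_polyC_leq1 _) _.
have {IH} qj : forall j, mult_of (tau ^+ M) q`_j.
  apply: IH => // [i il|i k il kl]; last by apply: RU; apply: leqW.
  have il1 := leqW il.
  apply: (unit_mod_cancel (x := R i - R l)); first by apply: RU => //; lia.
  have -> : (R i - R l) * q.[R i] = p.[R i] - p.[R l].
    by rewrite [in RHS]pq !(hornerD, hornerM, hornerN, hornerX, hornerC); ring.
  by apply: mult_ofD; [exact: pR|apply/mult_ofN/pR].
rewrite pq coefD mulrBr coefB coefMX coefMC coefC.
apply: mult_ofD; last by case: eqP => _; [exact: pR|exact: mult_of0].
apply: mult_ofD; first by case: eqP => _; [exact: mult_of0|exact: qj].
by apply: mult_ofN; rewrite mulrC; apply: mult_ofM.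
Qed.

(** Uniqueness of the Hensel lift of a factor. At R i the factor Q vanishes modulo tau, so f' is
    congruent to H Q' there and H is a unit. Hence f(R i) = 0 modulo tau^M gives Q(R i) = 0 modulo
    tau^M, and Q minus the product has degree below l and l distinct zeros. *)
Lemma factor_roots M l (R al be : nat -> B) (f Q H : {poly B}) : (0 < M)%N ->
  f = H * Q ->
  (forall i, (i < l)%N -> [/\ mult_of (tau ^+ M) f.[R i],
      cong tau f^`().[R i] (al i) & al i * be i = 1]) ->
  (forall i j, (i < l)%N -> (j < l)%N -> i != j -> unit_mod (R i - R j)) ->
  (size (Q - \prod_(i < l) ('X - (R i)%:P))%R <= l)%N ->
  cong_poly tau Q (\prod_(i < l) ('X - (R i)%:P)) ->
  cong_poly (tau ^+ M) Q (\prod_(i < l) ('X - (R i)%:P)).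
Proof.
move=> M0 fE fR RU sQ Q0.
have prodR i : (i < l)%N -> (\prod_(i < l) ('X - (R i)%:P)).[R i] = 0.
  move=> il; rewrite horner_prod (bigD1 (Ordinal il)) //=.
  by rewrite !hornerE subrr mul0r.
have QR0 i : (i < l)%N -> mult_of tau Q.[R i].
  move=> il; rewrite -[Q](subrK (\prod_(i < l) ('X - (R i)%:P))) hornerD prodR //.
  rewrite addr0 horner_coef; elim/big_ind: _ => [|x y|j _].
  - exact: mult_of0.
  - exact: mult_ofD.
  - by rewrite coefB mulrC; apply: mult_ofM; apply: Q0.
suff H0 j : mult_of (tau ^+ M) (Q - \prod_(i < l) ('X - (R i)%:P))`_j.
  by move=> j; have := H0 j; rewrite coefB.
apply: (vanish_distinct (R := R) sQ) => // i il.
rewrite hornerD hornerN prodR // subr0.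
have [fRi fRd albe] := fR i il.
have HU : unit_mod H.[R i].
  exists (be i * Q^`().[R i]).
  have [h hE] : cong tau (H.[R i] * Q^`().[R i]) (al i).
    apply: cong_trans fRd; apply: cong_sym.
    rewrite fE derivM hornerD !hornerM /cong addrK.
    by apply: mult_ofM; apply: QR0.
  rewrite /cong -albe; exists (be i * h).
  have -> : tau * (be i * h) = be i * (tau * h) by ring.
  by rewrite -hE; ring.
by apply: unit_mod_cancel HU _; rewrite -hornerM -fE.
Qed.

End Hensel.

Section DivisionByRoots.
Context (A : comNzRingType).
Implicit Types (f Q : {poly {poly A}}).

Lemma mult_of_XnP M (p : {poly A}) :
  mult_of 'X^M p <-> forall j, (j < M)%N -> p`_j = 0.
Proof.
split=> [[h ->] j jM|p0]; first by rewrite coefXnM jM.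
exists (drop_poly M p); rewrite -commr_polyXn -[LHS](poly_take_drop M).
rewrite (_ : take_poly M p = 0) ?add0r //.
by apply/polyP => j; rewrite coef_take_poly coef0; case: ltnP => // /p0.
Qed.

(** Long division with a record of the T-degree: each of the at most s steps multiplies Q by a
    coefficient of the current dividend and raises the bound by b. *)
Lemma monic_division l b Q : Q \is monic -> size Q = l.+1 ->
  (forall j, (size (Q`_j)%R <= b.+1)%N) ->
  forall s a f, (size f <= s)%N -> (forall j, (size (f`_j)%R <= a.+1)%N) ->
  exists H rem, [/\ f = H * Q + rem, (size rem <= l)%N
    & forall j, (size (rem`_j)%R <= (a + s * b).+1)%N].
Proof.
move=> monQ sQ Qb; elim=> [|s IH] a f fs fa.
  exists 0, f; rewrite mul0r add0r (leq_trans fs) //; split=> // j.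
  by rewrite addn0.
case: (leqP s.+1 l) => sl.
  exists 0, f; rewrite mul0r add0r (leq_trans fs) //; split=> // j.
  by apply: leq_trans (fa j) _; rewrite ltnS leq_addr.
pose g := (f`_s)%:P * 'X^(s - l).
have gQ j : (g * Q)`_j = if (j < s - l)%N then 0 else f`_s * Q`_(j - (s - l)).
  by rewrite /g -mulrA coefCM coefXnM; case: ifP; rewrite ?mulr0.
have [||H [rem [fE reml remb]]] := IH (a + b)%N (f - g * Q).
- apply/leq_sizeP => j sj; rewrite coefB gQ.
  rewrite ltnNge (leq_trans (leq_subr _ _) sj) /=.
  move: sj; rewrite leq_eqVlt => /predU1P[<-|sj].
    by rewrite subKn // -[l]/(l.+1.-1) -sQ -lead_coefE (monicP monQ) mulr1 subrr.
  rewrite [f`_j]nth_default ?[Q`_ _]nth_default ?mulr0 ?subr0 //.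
    by rewrite sQ; lia.
  exact: leq_trans fs sj.
- move=> j; rewrite coefB; apply: leq_trans (size_polyD _ _) _.
  rewrite geq_max size_polyN; apply/andP; split.
    by apply: leq_trans (fa j) _; lia.
  rewrite gQ; case: ifP => _; first by rewrite size_poly0.
  apply: leq_trans (size_polyMleq _ _) _.
  by move: (size _) (size _) (fa s) (Qb (j - (s - l))%N) => u v; lia.
exists (g + H), rem; split=> // [|j].
  by rewrite mulrDl -addrA -fE addrC subrK.
by apply: leq_trans (remb j) _; rewrite mulSn; lia.
Qed.

(** The remainder vanishes modulo T^M at l distinct points, hence is 0 modulo T^M; the bound a +
    size f * b < M on its T-degree then makes it zero. *)
Lemma divides_of_roots M l a b (R : nat -> {poly A}) f Q :
  Q \is monic -> size Q = l.+1 ->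
  (forall j, (size (Q`_j)%R <= b.+1)%N) ->
  (forall j, (size (f`_j)%R <= a.+1)%N) -> (a + size f * b < M)%N ->
  (forall i, (i < l)%N -> mult_of 'X^M f.[R i]) ->
  (forall i j, (i < l)%N -> (j < l)%N -> i != j -> unit_mod 'X (R i - R j)) ->
  cong_poly 'X^M Q (\prod_(i < l) ('X - (R i)%:P)) ->
  divides Q f.
Proof.
move=> monQ sQ Qb fa M0 fR RU QR.
have [H [rem [fE reml remb]]] := monic_division monQ sQ Qb (leqnn (size f)) fa.
exists H; rewrite fE [X in _ + X](_ : rem = 0) ?addr0 //.
apply/polyP => j; rewrite coef0.
have /mult_of_XnP rem0 : mult_of 'X^M rem`_j.
  apply: (vanish_distinct (R := R) reml) => // i il.
  have -> : rem.[R i] = f.[R i] - H.[R i] * Q.[R i].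
    by rewrite fE hornerD hornerM addrC addKr.
  apply: mult_ofD; first exact: fR.
  apply/mult_ofN/mult_ofM.
  rewrite -[Q](subrK (\prod_(i < l) ('X - (R i)%:P))) hornerD.
  rewrite [X in _ + X](_ : _ = 0); last first.
    by rewrite horner_prod (bigD1 (Ordinal il)) //= !hornerE subrr mul0r.
  rewrite addr0 horner_coef; elim/big_ind: _ => [|x y|k _].
  - exact: mult_of0.
  - exact: mult_ofD.
  - by rewrite coefB mulrC; apply: mult_ofM; apply: QR.
apply/polyP => i; rewrite coef0; case: (ltnP i M) => [/rem0//|Mi].
rewrite nth_default //; apply: leq_trans (remb j) _.
exact: leq_trans M0 Mi.
Qed.

End DivisionByRoots.

(** * Polynomial maps *)

Section PolynomialMaps.
Context (F : fieldType).

(** Identities between substitutions are checked on constants and variables by this lemma, which is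
    why their two sides are packaged as ring morphisms first. *)
Lemma mpoly_hom_ext n (R : nzRingType) (f g : {rmorphism {mpoly F[n]} -> R}) :
  (forall c, f c%:MP = g c%:MP) -> (forall i, f 'X_i = g 'X_i) -> f =1 g.
Proof.
move=> fgC fgX p; rewrite (mpolyE p) !rmorph_sum /=; apply: eq_bigr => m _.
rewrite -mul_mpolyC !rmorphM fgC; congr (_ * _).
by rewrite mpolyXE_id !rmorph_prod; apply: eq_bigr => i _; rewrite !rmorphXn fgX.
Qed.

Lemma comp_mpolyA n m k (p : {mpoly F[n]}) (v : n.-tuple {mpoly F[m]})
    (w : m.-tuple {mpoly F[k]}) :
  (p \mPo v) \mPo w = p \mPo [tuple tnth v i \mPo w | i < n].
Proof.
pose f : {rmorphism {mpoly F[n]} -> {mpoly F[k]}} := comp_mpoly w \o comp_mpoly v.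
pose g : {rmorphism {mpoly F[n]} -> {mpoly F[k]}} :=
  comp_mpoly [tuple tnth v i \mPo w | i < n].
apply: (mpoly_hom_ext (f := f) (g := g)) => [c|i].
  by rewrite /f /g /= !comp_mpolyC.
by rewrite /f /g /= !comp_mpolyXU -!tnth_nth tnth_mktuple.
Qed.

Lemma poly_nonroot (p : {poly F}) : [pchar F] =i pred0 -> p != 0 ->
  exists c, p.[c] != 0.
Proof.
move=> char0 p0; pose rs : seq F := [seq i%:R | i <- iota 0 (size p)].
have : ~~ all (root p) rs.
  apply/negP => rsp; have := max_poly_roots p0 rsp.
  rewrite map_inj_uniq ?iota_uniq ?size_map ?size_iota ?ltnn; last first.
    exact: pchar0_natr_inj.
  by move/(_ isT).
by case/allPn => c _ pc; exists c.
Qed.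

Lemma ord_maxP n (i : 'I_n.+1) :
  i = ord_max \/ exists j : 'I_n, i = widen_ord (leqnSn n) j.
Proof.
case: (unliftP ord_max i) => [j ->|->]; [right; exists j|by left].
by apply/val_inj; rewrite /= /bump leqNgt ltn_ord.
Qed.

Lemma muni_max n : muni ('X_ord_max : {mpoly F[n.+1]}) = 'X.
Proof.
rewrite muniE msuppX big_seq1 mcoeffX eqxx scale1r.
rewrite (_ : [multinom _ | i < n] = 0%MM) ?mpolyX0.
  by rewrite mnm1E eqxx expr1 scale1r.
by apply/mnmP => j; rewrite mnmE mnm1E mnm0E -val_eqE /= gtn_eqF.
Qed.

Lemma muni_widen n (j : 'I_n) :
  muni ('X_(widen_ord (leqnSn n) j) : {mpoly F[n.+1]}) = ('X_j)%:P.
Proof.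
rewrite muniE msuppX big_seq1 mcoeffX eqxx scale1r.
rewrite (_ : [multinom _ | i < n] = U_(j)%MM).
  by rewrite mnm1E -val_eqE /= ltn_eqF // expr0 alg_polyC.
by apply/mnmP => i; rewrite mnmE !mnm1E -val_eqE.
Qed.

Lemma mwidenXU n (j : 'I_n) :
  mwiden ('X_j : {mpoly F[n]}) = 'X_(widen_ord (leqnSn n) j).
Proof. by rewrite mwidenX mnmwiden1. Qed.

Lemma muniK n (p : {mpoly F[n.+1]}) :
  (map_poly (@mwiden n F) (muni p)).['X_ord_max] = p.
Proof.
pose f : {rmorphism {mpoly F[n.+1]} -> {mpoly F[n.+1]}} :=
  horner_eval ('X_ord_max : {mpoly F[n.+1]}) \o map_poly (@mwiden n F) \o @muni n F.
apply: (mpoly_hom_ext (f := f) (g := idfun)) => [c|i];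
  rewrite /f /= /horner_eval.
  by rewrite muniC map_polyC hornerC /= mwidenC.
case: (ord_maxP i) => [->|[j ->]].
  by rewrite muni_max map_polyX hornerX.
by rewrite muni_widen map_polyC hornerC /= mwidenXU.
Qed.

Lemma mpoly_nonroot n (p : {mpoly F[n]}) : [pchar F] =i pred0 -> p != 0 ->
  exists v, p.@[v] != 0.
Proof.
move=> char0; elim: n p => [|n IH] p p0.
  exists (fun=> 0); rewrite [p]nvar0_mpolyC mevalC.
  by apply: contraNneq p0 => p00; rewrite [p]nvar0_mpolyC p00 mpolyC0.
have mp0 : muni p != 0.
  by apply: contraNneq p0 => mp; rewrite -(muniK p) mp map_poly0 horner0.
have [v pv] : exists v, (lead_coef (muni p)).@[v] != 0.
  by apply: IH; rewrite lead_coef_eq0.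
pose q := map_poly (meval v) (muni p).
have [c qc] : exists c, q.[c] != 0.
  apply: poly_nonroot => //; apply: contraNneq pv => q0.
  by rewrite lead_coefE -[_.@[v]](coef_map (meval v)) -/q q0 coef0.
exists (fun i => if unlift ord_max i is Some j then v j else c).
set w := (fun i => _).
pose f : {rmorphism {mpoly F[n.+1]} -> F} :=
  horner_eval c \o map_poly (meval v) \o @muni n F.
rewrite (_ : p.@[w] = f p) //; apply: (mpoly_hom_ext (f := meval w)) => [d|i];
  rewrite /f /= /horner_eval.
  by rewrite mevalC muniC map_polyC hornerC /= mevalC.
case: (ord_maxP i) => [->|[j ->]]; rewrite mevalXU /w.
  by rewrite unlift_none muni_max map_polyX hornerX.
rewrite muni_widen map_polyC hornerC /= mevalXU.
have -> : widen_ord (leqnSn n) j = lift ord_max j.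
  by apply/val_inj; rewrite /= /bump leqNgt ltn_ord.
by rewrite liftK.
Qed.

(** Write p = q X + c. If g has positive degree, q(g) g = - c forces q(g) = 0, and induction strips
    p down to zero. *)
Lemma algebraic_const n (g : {mpoly F[n]}) (p : {poly F}) : p != 0 ->
  (map_poly (@mpolyC n F) p).[g] = 0 -> exists c, g = c%:MP.
Proof.
move=> p0 pg; have [/eqP g0|] := posnP (tdeg g).
  exists (g@_0%MM); apply/mpolyP => m; rewrite mcoeffC.
  have [->|m0] := eqVneq; first by rewrite mulr1.
  rewrite mulr0; apply/eqP; rewrite mcoeff_eq0; apply/negP => mg.
  have /tdeg_leP/(_ m mg) : (tdeg g <= 0)%N by rewrite (eqP g0).
  by rewrite leqn0 mdeg_eq0 (negPf m0).
move=> gpos; case/eqP: p0; elim/poly_ind: p pg => // p c IH.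
rewrite rmorphD rmorphM /= map_polyX map_polyC hornerMXaddC.
set q := _.[g] => qg; have q0 : q = 0.
  apply/eqP; apply: contraTT gpos => q0.
  have [->|g0] := eqVneq g 0; first by rewrite /tdeg msize0.
  have : (msize (q * g) <= 1)%N.
    have -> : q * g = (- c)%:MP.
      by apply/eqP; rewrite mpolyCN -subr_eq0 opprK; apply/eqP.
    by rewrite msizeC; case: (_ == _).
  rewrite msizeM // /tdeg; move: q0 g0; rewrite -!msize_poly_eq0.
  by move: (msize q) (msize g) => a b; lia.
have p0 := IH q0; rewrite p0 mul0r add0r.
by move: qg; rewrite q0 mul0r add0r => /eqP; rewrite mpolyC_eq0 => /eqP ->.
Qed.

End PolynomialMaps.

(** * Polynomials in few variables *)

Section LocalPolynomials.
Context (F : fieldType) (N : nat).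
Implicit Types (m : 'X_{1..N}) (p : {mpoly F[N]}).

Definition mnm_word m : seq 'I_N := flatten [seq nseq (m i) i | i <- enum 'I_N].

Lemma size_mnm_word m : size (mnm_word m) = mdeg m.
Proof.
rewrite size_flatten /shape -map_comp sumnE big_map mdegE big_enum /=.
by apply: eq_bigr => i _; rewrite size_nseq.
Qed.

Lemma count_mnm_word m i : count_mem i (mnm_word m) = m i.
Proof.
rewrite count_flatten -map_comp sumnE big_map big_enum /= (bigD1 i) //=.
rewrite count_nseq /= eqxx mul1n big1 ?addn0 // => j ji.
by rewrite count_nseq /= (negPf ji).
Qed.

Lemma mnm_word_inj : injective mnm_word.
Proof. by move=> m m' E; apply/mnmP => i; rewrite -!count_mnm_word E. Qed.

Lemma prod_mnm_word m : \prod_(i <- mnm_word m) 'X_i = 'X_[m] :> {mpoly F[N]}.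
Proof.
rewrite big_flatten big_map big_enum /= [RHS]mpolyXE_id; apply: eq_bigr => i _.
by rewrite big_nseq -Monoid.iteropE.
Qed.

(* A monomial of degree at most d in the variables V is determined by a word of
   length d over V and a blank. *)
Lemma size_msupp_local p (V : {set 'I_N}) d :
  {in msupp p, forall m i, m i != 0%N -> i \in V} -> (tdeg p <= d)%N ->
  (size (msupp p) <= #|V|.+1 ^ d)%N.
Proof.
move=> pV pd.
pose f m : {ffun 'I_d -> option 'I_N} := [ffun k : 'I_d => onth (mnm_word m) k].
pose S := [pred o : option 'I_N | if o is Some i then i \in V else true].
have wd m : m \in msupp p -> (size (mnm_word m) <= d)%N.
  by move=> mp; rewrite size_mnm_word; move: m mp; apply/tdeg_leP.
have cS : (#|S| = #|V|.+1)%N.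
  rewrite (cardD1 None) add1n; congr _.+1.
  rewrite -(card_image (@Some_inj _)); apply: eq_card => -[i|]; rewrite !inE /=.
    by rewrite mem_image //; exact: Some_inj.
  by symmetry; apply/negbTE/negP => /imageP[].
rewrite -cS -[X in (_ ^ X)%N](card_ord d) -card_ffun_on -(size_map f) cardE.
apply: uniq_leq_size.
  rewrite map_inj_in_uniq ?msupp_uniq // => m m' mp m'p /ffunP ff.
  apply: mnm_word_inj; apply: eq_from_onth_le => k kd.
  have {}kd : (k < d)%N by apply: leq_trans kd _; rewrite geq_max !wd.
  by have := ff (Ordinal kd); rewrite !ffunE.
move=> _ /mapP[m mp ->]; rewrite mem_enum; apply/ffun_onP => k; rewrite ffunE.
case E : (onth _ _) => [i|] //; rewrite inE; apply: (pV m mp).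
rewrite -count_mnm_word -lt0n -has_count has_pred1.
by apply/onthP; exists k.
Qed.

End LocalPolynomials.

Section FeasibleConstructions.
Context (F : fieldType) (char0 : [pchar F] =i pred0) (W : nat) (W2 : (1 < W)%N).

(** The sum of all monomials of p: one level each for the products, the scalars and the sum. *)
Lemma feas_local N (p : {mpoly F[N]}) (V : {set 'I_N}) d c :
  {in msupp p, forall (m : 'X_{1..N}) i, m i != 0%N -> i \in V} ->
  (tdeg p <= d)%N -> (d <= W ^ c)%N -> (#|V|.+1 ^ d <= W ^ c)%N ->
  feas W 3 (2 * c + 4) p.
Proof.
(* [feas_lin] wants a bound for every index; outside the support the degree of a monomial is not
   controlled, hence the value 0 there. *)
move=> pV pd dc Vc; pose f m : {mpoly F[N]} := if m \in msupp p then 'X_[m] else 0.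
have -> : p = \sum_(m <- msupp p) p@_m *: f m.
  by rewrite {1}(mpolyE p); apply: eq_big_seq => m; rewrite /f => ->.
have -> : (2 * c + 4 = (c + c.+1).+3)%N by lia.
apply: feas_lin => // [|m]; first exact: leq_trans (size_msupp_local pV pd) Vc.
rewrite /f; case: ifP => mp; last exact: feas0.
have cE : c.+1 = (c + 0).+1 by rewrite addn0.
rewrite -prod_mnm_word cE; apply: feas_prod => // [|i].
  rewrite size_mnm_word; apply: leq_trans dc.
  by move: m mp; apply/tdeg_leP.
exact: feasX.
Qed.

Context (n : nat).
Let A : comNzRingType := {mpoly F[n]}.

Definition mmap2 N (v : 'I_N -> {poly {poly A}}) (p : {mpoly F[N]}) : {poly {poly A}} :=
  mmap (polyC \o polyC \o @mpolyC n F) v p.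

Lemma box_mmap2 N (v : 'I_N -> {poly {poly A}}) p B :
  (forall i, box B (v i)) -> box (tdeg p * B) (mmap2 v p).
Proof.
move=> vB; rewrite /mmap2 /mmap big_seq; elim/big_ind: _ => [|q q'|m mp].
- exact: (box_const 0).
- exact: boxD.
rewrite -[(tdeg p * B)%N]add0n; apply: boxM; first exact: box_const.
apply: (@box_mono _ (mdeg m * B)).
  by rewrite leq_mul2r; apply/orP; right; move: m mp; apply/tdeg_leP.
rewrite mdegE big_distrl /= /mmap1.
elim/big_ind2: _ => [|q b q' b'|i _]; [exact: (box_const 1)|exact: boxM|].
have := box_prod (nseq (m i) tt) (fun _ => vB i).
by rewrite size_nseq big_nseq -Monoid.iteropE.
Qed.

Lemma eval2_mmap2 N (v : 'I_N -> {poly {poly A}}) p c c' :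
  eval2 c c' (mmap2 v p) = p \mPo [tuple eval2 c c' (v i) | i < N].
Proof.
pose f : {rmorphism {mpoly F[N]} -> A} :=
  horner_eval (c%:MP : A) \o horner_eval ((c'%:MP : A)%:P)
    \o mmap (polyC \o polyC \o @mpolyC n F) v.
apply: (mpoly_hom_ext (f := f)) => [a|i]; rewrite /f /= /horner_eval.
  by rewrite mmapC /= !hornerC comp_mpolyC.
by rewrite mmapX mmap1U comp_mpolyXU -tnth_nth tnth_mktuple.
Qed.

(** The v i enter through their values at scalars only: the substitution is done at each point, and
    a single interpolation at the end adds two levels. *)
Lemma bfeas_mmap2 N (v : 'I_N -> {poly {poly A}}) p D b D' e :
  feas W D b p -> (forall i, box (W ^ e) (v i)) ->
  (forall i c c', feas W D' e (eval2 c c' (v i) : {mpoly F[n]})) ->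
  bfeas W (D + D').+2 (3 * (b + e) + 11) (mmap2 v p).
Proof.
move=> pD vB vD; have -> : (3 * (b + e) + 11 = 3 * (b + e).+2 + 5)%N by lia.
apply: bfeas_interp => // [|c c'].
  apply: box_mono (box_mmap2 p vB).
  apply: leq_trans (leq_mul pD.2 (leqnn _)) _.
  by rewrite -expnD leq_exp2l //; lia.
rewrite eval2_mmap2; apply: feas_subst => // i; rewrite tnth_mktuple; exact: vD.
Qed.

End FeasibleConstructions.

(** * The hybrid argument *)

Section Locality.
Context (F : fieldType) (N : nat).

Implicit Types (V : {set 'I_N}) (p q : {mpoly F[N]}).

Definition local (V : {set 'I_N}) (p : {mpoly F[N]}) : Prop :=
  {in msupp p, forall (m : 'X_{1..N}) i, m i != 0%N -> i \in V}.

Lemma localC V c : local V c%:MP.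
Proof. by move=> m; rewrite msuppC; case: ifP => // _; rewrite inE => /eqP -> i;
  rewrite mnm0E. Qed.

Lemma localX V i : i \in V -> local V 'X_i.
Proof.
move=> iV m; rewrite msuppX inE => /eqP -> j; rewrite mnm1E.
by case: (i =P j) => [<-|].
Qed.

Lemma localD V p q : local V p -> local V q -> local V (p + q).
Proof. by move=> pV qV m /msuppD_le; rewrite mem_cat => /orP[/pV|/qV]. Qed.

Lemma localM V p q : local V p -> local V q -> local V (p * q).
Proof.
move=> pV qV m /msuppM_le /allpairsP[[m1 m2] /= [m1p m2q ->]] i.
rewrite mnmDE addn_eq0 negb_and => /orP[]; [exact: pV|exact: qV].
Qed.

Lemma localN V p : local V p -> local V (- p).
Proof. by move=> pV m; rewrite (perm_mem (msuppN p)); apply: pV. Qed.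

Lemma local_comp V N' (p : {mpoly F[N']}) (lq : N'.-tuple {mpoly F[N]}) :
  (forall i, local V (tnth lq i)) -> local V (p \mPo lq).
Proof.
move=> lqV; rewrite comp_mpolyEX; elim/big_ind: _ => [|q q'|m _].
- by rewrite -mpolyC0; apply: localC.
- exact: localD.
rewrite -mul_mpolyC; apply: localM; first exact: localC.
rewrite comp_mpolyX; elim/big_ind: _ => [|q q'|i _].
- by rewrite -mpolyC1; apply: localC.
- exact: localM.
elim: (m i) => [|k IH]; first by rewrite expr0 -mpolyC1; apply: localC.
by rewrite exprS; apply: localM.
Qed.

End Locality.

Section Hybrid.
Context (F : fieldType) (char0 : [pchar F] =i pred0).
Context (n sigma mu : nat) (S : 'I_n -> {set 'I_mu}).
Context (Ssigma : forall i, #|S i| = sigma) (g : {mpoly F[sigma]}).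
Context (G : {mpoly F[n]}).
Let A : comNzRingType := {mpoly F[sigma]}.

(* The variables in S i become the variables of g, the others are fixed. *)
Definition restriction (i : 'I_n) (a : 'I_mu -> F) : mu.-tuple {mpoly F[sigma]} :=
  [tuple if insub (index v (enum (S i))) is Some k then 'X_k else (a v)%:MP
   | v < mu].

(** The main variable stands for coordinate i: the value b i gives the hybrid before that coordinate
    is replaced, the value g the hybrid after. *)
Definition hybrid_arg (i : 'I_n) (b : 'I_n -> F) a (j : 'I_n) : {poly A} :=
  if (j < i)%N then (KI g S j \mPo restriction i a : A)%:P
  else if j == i then 'X else ((b j)%:MP : A)%:P.

Definition hybrid i b a : {poly A} :=
  mmap (polyC \o @mpolyC sigma F) (hybrid_arg i b a) G.

Let size_enumS i : size (enum (S i)) = sigma.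
Proof. by rewrite -cardE Ssigma. Qed.

Lemma restriction_nth i a (k : 'I_sigma) (v0 : 'I_mu) :
  tnth (restriction i a) (nth v0 (enum (S i)) k) = 'X_k.
Proof.
rewrite tnth_mktuple index_uniq ?enum_uniq ?size_enumS //.
by rewrite insubT //= => ?; congr ('X__); apply: val_inj.
Qed.

Lemma KI_restriction j a (lq : mu.-tuple {mpoly F[sigma]}) :
  KI g S j \mPo lq =
    g \mPo [tuple tnth lq (nth (a : 'I_mu) (enum (S j)) k) | k < sigma].
Proof.
rewrite /KI comp_mpolyA; congr (_ \mPo _); apply: eq_from_tnth => k.
rewrite !tnth_mktuple (nth_map a) ?size_enumS //.
by rewrite comp_mpolyXU -tnth_nth.
Qed.

Lemma KI_restriction_self i a : KI g S i \mPo restriction i a = g.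
Proof.
(* [KI_restriction] takes a default variable index; for sigma = 0 there may be none, but then the
   tuples are empty. *)
have [s0|[k0]] : (sigma = 0)%N \/ inhabited 'I_sigma.
    case: (posnP sigma) => [|s0]; [by left|right].
    by constructor; exists 0%N.
  rewrite /KI comp_mpolyA; set t := [tuple _ | _ < _].
  have -> : t = [tuple 'X_i | i < sigma].
    by apply: eq_from_tnth => k; have := ltn_ord k; rewrite {2}s0.
  exact: comp_mpoly_id.
have [v0 _] : exists v0, v0 \in S i.
  apply/set0Pn; rewrite -card_gt0 Ssigma; exact: leq_ltn_trans (ltn_ord k0).
rewrite (KI_restriction _ v0) -[RHS]comp_mpoly_id; congr (_ \mPo _).
by apply: eq_from_tnth => k; rewrite tnth_mktuple restriction_nth tnth_mktuple.
Qed.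

Let hyb (b : 'I_n -> F) (i : nat) : {mpoly F[mu]} :=
  G \mPo [tuple if (j < i)%N then KI g S j else (b j)%:MP | j < n].

(* Replacing the constants b by the coordinates of the map one at a time turns
   G b, which is nonzero, into 0: i is where the first zero appears. *)
Lemma hybrid_root : G != 0 -> G \mPo [tuple KI g S i | i < n] = 0 ->
  exists i b a, hybrid i b a != 0 /\ (hybrid i b a).[g] = 0.
Proof.
move=> G0 GKI; have [b Gb] := mpoly_nonroot char0 G0.
have h0 : hyb b 0 != 0.
  apply: contraNneq Gb => h0; have := congr1 (meval (fun=> 0)) h0.
  rewrite meval0 comp_mpoly_meval => <-; apply/eqP/esym/meval_eq => j.
  by rewrite tnth_mktuple mevalC.
have hn : hyb b n = 0.
  rewrite -GKI /hyb; congr (_ \mPo _); apply: eq_from_tnth => j.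
  by rewrite !tnth_mktuple ltn_ord.
have [i [iN hi hi1]] : exists i, [/\ (i < n)%N, hyb b i != 0 & hyb b i.+1 = 0].
  have ex : exists i, hyb b i == 0 by exists n; rewrite hn.
  case: (ex_minnP ex) => -[|i] /eqP hi imin; first by rewrite hi eqxx in h0.
  exists i; split; [by apply: imin; rewrite hn| |exact: hi].
  by apply/negP => /imin; rewrite ltnn.
have [a ha] := mpoly_nonroot char0 hi.
exists (Ordinal iN), b, a; split.
  apply: contraNneq ha => H; set io := Ordinal iN in H.
  (* u transports the coordinates of a in S i to the variables of g. Evaluated at u and b i, a zero
     hybrid polynomial would make the hybrid before i vanish at a. *)
  pose u (k : 'I_sigma) :=
    if [pick v | (v \in S io) && (index v (enum (S io)) == k)] is Some v
    then a v else 0.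
  have ru v : (tnth (restriction io a) v).@[u] = a v.
    rewrite tnth_mktuple; case: insubP => [k _ kE|_]; last by rewrite mevalC.
    have vS : v \in S io by rewrite -mem_enum -index_mem size_enumS -kE ltn_ord.
    rewrite mevalXU /u; case: pickP => [v' /andP[v'S /eqP v'k]|/(_ v)]; last first.
      by rewrite vS -kE eqxx.
    congr a; have := congr1 (nth v (enum (S io))) (etrans v'k kE).
    by rewrite !nth_index ?mem_enum.
  pose f : {rmorphism {mpoly F[n]} -> F} :=
    meval u \o horner_eval ((b io)%:MP : A)
      \o mmap (polyC \o @mpolyC sigma F) (hybrid_arg io b a).
  pose f' : {rmorphism {mpoly F[n]} -> F} := meval a \o
    comp_mpoly [tuple if (j < i)%N then KI g S j else (b j)%:MP | j < n].
  have -> : (hyb b i).@[a] = f G.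
    apply: (mpoly_hom_ext (f := f') (g := f)) => [c|j];
      rewrite /f /f' /= /horner_eval.
      by rewrite comp_mpolyC mmapC /= hornerC !mevalC.
    rewrite comp_mpolyXU -tnth_nth tnth_mktuple mmapX mmap1U /hybrid_arg /=.
    case: ltnP => [ji|ij].
      rewrite hornerC [RHS]comp_mpoly_meval; apply: meval_eq => v.
      by rewrite [RHS]ru.
    by case: eqP => [->|_]; rewrite ?hornerX ?hornerC !mevalC.
  by rewrite /f /= -/(hybrid _ _ _) H /horner_eval horner0 meval0.
set io := Ordinal iN.
pose f : {rmorphism {mpoly F[n]} -> A} :=
  horner_eval (g : A) \o mmap (polyC \o @mpolyC sigma F) (hybrid_arg io b a).
pose f' : {rmorphism {mpoly F[n]} -> A} := comp_mpoly (restriction io a) \o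
  comp_mpoly [tuple if (j < i.+1)%N then KI g S j else (b j)%:MP | j < n].
rewrite -[LHS]/(f G); transitivity (f' G); last first.
  by rewrite /f' /= -/(hyb b i.+1) hi1 comp_mpoly0.
apply: (mpoly_hom_ext (f := f) (g := f')) => [c|j];
  rewrite /f /f' /= /horner_eval.
  by rewrite !comp_mpolyC mmapC /= hornerC.
rewrite comp_mpolyXU -tnth_nth tnth_mktuple mmapX mmap1U /hybrid_arg /= ltnS.
case: (ltngtP j i) => [ji|ij|ji].
- by rewrite hornerC.
- by rewrite -val_eqE /= gtn_eqF // hornerC comp_mpolyC.
- have -> : j = io by apply: val_inj.
  by rewrite eqxx hornerX KI_restriction_self.
Qed.

(** After the restriction to S i, g(w_{S j}) keeps only variables that lie in both sets. The further
    substitution lq acts on each variable separately, which covers the identity and the points of a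
    line. *)
Lemma KI_restriction_local i j a (lq : sigma.-tuple {mpoly F[sigma]}) :
  (forall k, local [set k] (tnth lq k)) ->
  (forall k, (tdeg (tnth lq k) <= 1)%N) ->
  exists V : {set 'I_sigma}, [/\ (#|V| <= #|S i :&: S j|)%N,
    local V ((KI g S j \mPo restriction i a) \mPo lq)
    & (tdeg ((KI g S j \mPo restriction i a) \mPo lq) <= tdeg g)%N].
Proof.
move=> lqV lq1; pose idx v : option 'I_sigma := insub (index v (enum (S i))).
pose V := [set k | Some k \in [set idx v | v in S i :&: S j]].
rewrite /KI !comp_mpolyA; set t := [tuple _ | _ < _].
have tP k : local V (tnth t k) /\ (tdeg (tnth t k) <= 1)%N.
  rewrite !tnth_mktuple.
  have /mapP[v vS ->] : ([seq 'X_v | v <- enum (S j)]`_k : {mpoly F[mu]})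
      \in [seq 'X_v | v <- enum (S j)].
    by rewrite mem_nth // size_map size_enumS.
  rewrite comp_mpolyXU -tnth_nth tnth_mktuple tnth_mktuple.
  case E: (insub _) => [k'|]; last first.
    by rewrite comp_mpolyC tdegC; split=> //; apply: localC.
  rewrite comp_mpolyXU -tnth_nth; split=> // m mlq i0 /(lqV k' m mlq).
  rewrite !inE => /eqP ->; apply/imsetP; exists v => //.
  rewrite inE -[v \in S j]mem_enum vS andbT -mem_enum -index_mem size_enumS.
  by case: insubP E => // k'' _ <- [<-]; apply: ltn_ord.
exists V; split.
- rewrite -(card_imset V (@Some_inj _)).
  apply: leq_trans (leq_imset_card idx _); apply: subset_leq_card.
  by apply/subsetP => _ /imsetP[k kV ->]; move: kV; rewrite inE.
- by apply: local_comp => k; case: (tP k).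
- by rewrite -[tdeg g]muln1; apply: tdeg_comp => k; case: (tP k).
Qed.

End Hybrid.

(** * Recovering g as a simple root along a line *)

Section Shift.
Context (F : fieldType) (N : nat) (a : 'I_N -> F).
Let A : comNzRingType := {mpoly F[N]}.

(* The line from a to the generic point u, parametrized by T: p (a + T (u - a)). *)
Definition line_arg (k : 'I_N) : {poly A} :=
  ((a k)%:MP : A)%:P + 'X * ('X_k - (a k)%:MP : A)%:P.

Definition along_line (p : {mpoly F[N]}) : {poly A} :=
  mmap (polyC \o @mpolyC N F) line_arg p.

HB.instance Definition _ :=
  GRing.RMorphism.copy along_line (mmap (polyC \o @mpolyC N F) line_arg).

Lemma along_lineC c : along_line c%:MP = (c%:MP : A)%:P.
Proof. by rewrite /along_line mmapC. Qed.

Definition line_at (c : F) : N.-tuple {mpoly F[N]} :=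
  [tuple (a k)%:MP + c *: ('X_k - (a k)%:MP) | k < N].

Lemma along_line_eval c p : (along_line p).[c%:MP] = p \mPo line_at c.
Proof.
pose f : {rmorphism {mpoly F[N]} -> A} := horner_eval (c%:MP : A) \o along_line.
apply: (mpoly_hom_ext (f := f)) => [e|k]; rewrite /f /= /horner_eval.
  by rewrite along_lineC hornerC comp_mpolyC.
rewrite comp_mpolyXU -tnth_nth tnth_mktuple /along_line mmapX mmap1U /line_arg.
by rewrite hornerD hornerM !hornerC hornerX mul_mpolyC.
Qed.

Lemma along_line0 p : (along_line p).[0] = (p.@[a])%:MP.
Proof.
rewrite -mpolyC0 along_line_eval.
pose f : {rmorphism {mpoly F[N]} -> {mpoly F[N]}} := comp_mpoly (line_at 0).
pose f' : {rmorphism {mpoly F[N]} -> {mpoly F[N]}} := @mpolyC N F \o meval a.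
apply: (mpoly_hom_ext (f := f) (g := f')) => [e|k]; rewrite /f /f' /=.
  by rewrite comp_mpolyC mevalC.
by rewrite comp_mpolyXU -tnth_nth tnth_mktuple scale0r addr0 mevalXU.
Qed.

Lemma along_line1 p : (along_line p).[1] = p.
Proof.
rewrite -mpolyC1 along_line_eval -[RHS]comp_mpoly_id; congr (_ \mPo _).
by apply: eq_from_tnth => k; rewrite !tnth_mktuple scale1r addrC subrK.
Qed.

Lemma size_along_line p : (size (along_line p) <= (tdeg p).+1)%N.
Proof.
pose v k : {poly {poly A}} := (line_arg k)%:P.
have vB k : box 1 (v k).
  rewrite /v /line_arg polyCD polyCM; apply: boxD; first exact: box_const.
  by rewrite -[1%N]addn0; apply: boxM; [exact: boxXC|exact: box_const].
have [_ /(_ 0%N)] := box_mmap2 p vB; rewrite muln1.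
suff -> : mmap2 v p = (along_line p)%:P by rewrite coefC.
pose f : {rmorphism {mpoly F[N]} -> {poly {poly A}}} :=
  mmap (polyC \o polyC \o @mpolyC N F) v.
pose f' : {rmorphism {mpoly F[N]} -> {poly {poly A}}} := polyC \o along_line.
apply: (mpoly_hom_ext (f := f) (g := f')) => [c|k]; rewrite /f /f' /=.
  by rewrite mmapC along_lineC.
by rewrite mmapX mmap1U /along_line mmapX mmap1U.
Qed.

Lemma line_at_local c k : local [set k] (tnth (line_at c) k).
Proof.
rewrite tnth_mktuple -mul_mpolyC; apply: localD; first exact: localC.
apply: localM; first exact: localC.
by apply: localD; [apply: localX; rewrite inE|apply/localN/localC].
Qed.

Lemma tdeg_line_at c k : (tdeg (tnth (line_at c) k) <= 1)%N.
Proof.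
rewrite tnth_mktuple; apply: tdegD; first by rewrite tdegC.
apply: leq_trans (tdegZ _ _) _; rewrite -mpolyCN.
by apply: tdegD; rewrite ?tdegXU ?tdegC.
Qed.

End Shift.

Section DerivedPolynomials.
Context (R : idomainType).
Implicit Types (p : {poly R}).

(** The first derivative that does not vanish at x comes right after the wanted one. It exists
    because the derivative of order deg p is a nonzero constant. *)
Lemma simple_derivative_root p x : (forall m, m.+1%:R != 0 :> R) -> p != 0 -> p.[x] = 0 ->
  exists e, (p^`(e)).[x] = 0 /\ (p^`(e.+1)).[x] != 0.
Proof.
move=> nat0 p0 px.
have ex : exists d, (p^`(d)).[x] != 0.
  exists (size p).-1.
  have sp : (0 < size p)%N by rewrite size_poly_gt0.
  have -> : p^`((size p).-1) = (lead_coef p *+ (size p).-1`!)%:P.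
    apply/polyP => i; rewrite coef_derivn coefC; case: eqP => [->|/eqP i0].
      by rewrite addn0 ffactnn lead_coefE.
    by rewrite nth_default ?mul0rn //; move: i0 sp; move: (size p) => s; lia.
  rewrite hornerC -mulr_natr mulf_neq0 ?lead_coef_eq0 //.
  by rewrite -(prednK (fact_gt0 _)).
case: (ex_minnP ex) => -[|e] pe emin; first by rewrite derivn0 px eqxx in pe.
exists e; split=> //; apply/eqP; apply: contraT => /emin; by rewrite ltnn.
Qed.

End DerivedPolynomials.

Lemma derivn_comp_shift (R : comNzRingType) (p : {poly R}) c m :
  (p \Po ('X + c%:P))^`(m) = p^`(m) \Po ('X + c%:P).
Proof.
elim: m => [|m IH]; first by rewrite !derivn0.
by rewrite !derivnS IH deriv_comp derivD derivX derivC addr0 mulr1.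
Qed.

Section KIRoot.
Context (F : fieldType) (char0 : [pchar F] =i pred0).
Context (n sigma mu : nat) (S : 'I_n -> {set 'I_mu}).
Context (Ssigma : forall i, #|S i| = sigma) (g : {mpoly F[sigma]}).
Context (G : {mpoly F[n]}) (G0 : G != 0).
Context (GKI : G \mPo [tuple KI g S i | i < n] = 0).
Let A : comNzRingType := {mpoly F[sigma]}.

Lemma local0 N (V : {set 'I_N}) (p : {mpoly F[N]}) : #|V| = 0%N ->
  local V p -> p = (p@_0%MM)%:MP.
Proof.
move=> /eqP; rewrite cards_eq0 => /eqP -> pV; apply/mpolyP => m.
rewrite mcoeffC; have [->|m0] := eqVneq; first by rewrite mulr1.
rewrite mulr0; apply/eqP; rewrite mcoeff_eq0; apply: contra m0 => mp.
apply/eqP/mnmP => i; rewrite mnm0E; apply/eqP; apply: contraT => mi.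
by have := pV m mp i mi; rewrite inE.
Qed.

Lemma idtuple_local N (k : 'I_N) :
  local [set k] (tnth [tuple ('X_i : {mpoly F[N]}) | i < N] k).
Proof. by rewrite tnth_mktuple; apply: localX; rewrite inE. Qed.

Lemma tdeg_idtuple N (k : 'I_N) :
  (tdeg (tnth [tuple ('X_i : {mpoly F[N]}) | i < N] k) <= 1)%N.
Proof. by rewrite tnth_mktuple tdegXU. Qed.

Lemma KI_disjoint_const : (forall i j, i != j -> (#|S i :&: S j| <= 0)%N) ->
  exists c, g = c%:MP.
Proof.
move=> Sdisj; have [i [b [a [h0 hg]]]] := hybrid_root char0 Ssigma G0 GKI.
pose h := hybrid S g G i b a.
pose ev0 : {rmorphism {mpoly F[sigma]} -> F} := meval (fun=> 0).
have hC : map_poly (@mpolyC sigma F) (map_poly ev0 h) = h.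
  pose f : {rmorphism {mpoly F[n]} -> {poly A}} :=
    mmap (polyC \o @mpolyC sigma F) (hybrid_arg S g i b a).
  pose f' : {rmorphism {mpoly F[n]} -> {poly A}} :=
    map_poly (@mpolyC sigma F) \o map_poly ev0 \o f.
  apply: (mpoly_hom_ext (f := f') (g := f)) => [c|j]; rewrite /f' /f /=.
    by rewrite mmapC /= !map_polyC /= mevalC.
  rewrite mmapX mmap1U /hybrid_arg; case: ltnP => [ji|_]; last first.
    by case: eqP => _; rewrite ?map_polyX // !map_polyC /= mevalC.
  have ij : i != j by rewrite -val_eqE /= gtn_eqF.
  have [V [Vc Vl _]] := KI_restriction_local Ssigma g i j a
    (@idtuple_local sigma) (@tdeg_idtuple sigma).
  rewrite comp_mpoly_id in Vl.
  have -> := local0 _ Vl; last by apply/eqP; rewrite -leqn0 (leq_trans Vc) ?Sdisj.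
  by rewrite !map_polyC /= mevalC.
apply: (@algebraic_const _ _ _ (map_poly ev0 h)).
  by apply: contraNneq h0 => p0; rewrite -/h -hC p0 map_poly0.
by rewrite hC.
Qed.

Context (W : nat) (W2 : (1 < W)%N) (rho c D b : nat).
Context (Srho : forall i j, i != j -> (#|S i :&: S j| < rho)%N).
Context (dc : ((tdeg g).+1 <= W ^ c)%N) (rhoc : (rho ^ tdeg g <= W ^ c)%N).

(** Coefficients are shifted and scaled, so a derivative of any order costs one level. This matters
    because the order used can be as large as the degree of Phi. *)
Lemma bfeas_derivn m (f : {poly {poly A}}) D' b' :
  bfeas W D' b' f -> bfeas W D'.+1 b'.+2 f^`(m).
Proof.
move=> [[sf cf] fD].
have WW : (W ^ b' <= W ^ b'.+2)%N by rewrite leq_exp2l //; lia.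
split=> [|i j]; last by rewrite coef_derivn coefMn -scaler_nat; apply: feasZ.
apply: (box_mono WW); split=> [|j].
  apply/leq_sizeP => j ij; rewrite coef_derivn nth_default ?mul0rn //.
  by apply: leq_trans sf (leq_trans ij (leq_addl _ _)).
apply/leq_sizeP => i ji; rewrite coef_derivn coefMn nth_default ?mul0rn //.
exact: leq_trans (cf _) ji.
Qed.

Let rdeg := (729 * (3 * b + 6 * c + 33) + 253 * c + 3)%N.

Lemma KI_extract : feas W D b G -> feas W (D + 27) rdeg g.
Proof.
move=> GD; have [i [b0 [a0 [h0 hg]]]] := hybrid_root char0 Ssigma G0 GKI.
set Phi := hybrid S g G i b0 a0 in h0 hg.
have [|e [Pe0 Pe1]] := simple_derivative_root _ h0 hg.
  move=> m; have -> : m.+1%:R = (m.+1%:R)%:MP :> A by rewrite rmorph_nat.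
  by have /pcharf0P nat0 := char0; rewrite mpolyC_eq0 nat0.
(* At a the derivative of order e + 1 takes a nonzero scalar value al, the linear coefficient that
   the inversion has to divide by. *)
have [a al0] := mpoly_nonroot char0 Pe1.
set al := meval _ _ in al0.
pose s : {rmorphism {mpoly F[sigma]} -> {poly A}} := along_line a.
(* Subtracting g(a) makes the unknown root, g along the line, vanish at T = 0. *)
pose y1 : {poly A} := ((g.@[a])%:MP : A)%:P.
pose h j : A := KI g S j \mPo restriction sigma S i a0.
(* The circuit of G is reused: fed with these arguments it gives Phi along the line, with g(a) added
   to the main variable. *)
pose v (j : 'I_n) : {poly {poly A}} :=
  if (j < i)%N then (s (h j))%:P
  else if j == i then 'X + y1%:P else scalar2 sigma (b0 j).
have PhiE : mmap2 v G = map_poly s Phi \Po ('X + y1%:P).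
  pose f1 : {rmorphism {mpoly F[n]} -> {poly {poly A}}} :=
    mmap (polyC \o polyC \o @mpolyC sigma F) v.
  pose f2 : {rmorphism {mpoly F[n]} -> {poly {poly A}}} :=
    comp_poly ('X + y1%:P) \o map_poly s
      \o mmap (polyC \o @mpolyC sigma F) (hybrid_arg S g i b0 a0).
  apply: (mpoly_hom_ext (f := f1) (g := f2)) => [k|j]; rewrite /f1 /f2 /=.
    by rewrite !mmapC /= map_polyC comp_polyC /= along_lineC.
  rewrite !mmapX !mmap1U /v /hybrid_arg; case: ifP => _.
    by rewrite map_polyC comp_polyC.
  case: ifP => _; first by rewrite map_polyX comp_polyX.
  by rewrite map_polyC comp_polyC /= along_lineC.
clearbody Phi.
have fE m : (mmap2 v G)^`(m) = map_poly s Phi^`(m) \Po ('X + y1%:P).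
  by rewrite PhiE (derivn_comp_shift (map_poly s Phi) y1 m) -derivn_map.
have f_at m y : ((mmap2 v G)^`(m)).[y] = (map_poly s Phi^`(m)).[y + y1].
  by rewrite fE horner_comp hornerD hornerX hornerC.
have mod0 (p : {poly A}) : ((map_poly s p).[y1]).[0] = ((p.[g]).@[a])%:MP.
  pose phi : {rmorphism {poly A} -> A} := horner_eval (0 : A).
  pose psi : {rmorphism A -> A} := @mpolyC sigma F \o meval a.
  rewrite -[LHS]/(phi _) -[RHS]/(psi _) -!horner_map /= -map_poly_comp.
  rewrite (_ : phi y1 = psi g); last by rewrite /phi /= /horner_eval hornerC.
  by congr (_.[_]); apply: eq_map_poly => q; rewrite /phi /= /horner_eval along_line0.
have mult0 (p : {poly A}) : p.[0] = 0 -> mult_of 'X p.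
  move=> p0; have /factor_theorem[q ->] : root p 0 by apply/rootP.
  by exists q; rewrite polyC0 subr0 mulrC.
have [hV hd] : (forall (j : 'I_n) c1, (j < i)%N -> exists V : {set 'I_sigma},
      [/\ (#|V| < rho)%N, local V (h j \mPo line_at a c1)
        & (tdeg (h j \mPo line_at a c1) <= tdeg g)%N]) /\
    (forall j, (tdeg (h j) <= tdeg g)%N).
  split=> [j c1 ji|j]; last first.
    have [V [_ _]] := KI_restriction_local Ssigma g i j a0
      (@idtuple_local sigma) (@tdeg_idtuple sigma).
    by rewrite comp_mpoly_id.
  have ij : i != j by rewrite -val_eqE /= gtn_eqF.
  have [V [Vc Vl Vd]] := KI_restriction_local Ssigma g i j a0
    (@line_at_local _ _ a c1) (@tdeg_line_at _ _ a c1).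
  by exists V; split=> //; apply: leq_ltn_trans Vc (Srho ij).
have vB j : box (W ^ (2 * c + 4)) (v j).
  have dB : (tdeg g <= W ^ (2 * c + 4))%N.
    apply: leq_trans (ltnW dc) _; rewrite leq_exp2l //; lia.
  rewrite /v; case: ifP => _; last case: ifP => _.
  - split=> [|k]; first by rewrite (leq_trans (size_polyC_leq1 _)).
    rewrite coefC; case: eqP => _; last by rewrite size_poly0.
    by apply: leq_trans (size_along_line _ _) _; rewrite ltnS (leq_trans (hd j)).
  - apply: boxD; last exact: box_const.
    by rewrite -(prednK (_ : 0 < W ^ (2 * c + 4))%N) ?expn_gt0 ?(ltnW W2) //; apply: boxX.
  - exact: box_const.
have vD j c1 c2 : feas W 3 (2 * c + 4) (eval2 c1 c2 (v j) : {mpoly F[sigma]}).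
  rewrite /v /eval2; case: ifP => ji; last case: ifP => _.
  - rewrite hornerC /= along_line_eval.
    have [V [Vc Vl Vd]] := hV j c1 ji.
    apply: (feas_local W2 Vl Vd); first exact: ltnW.
    apply: leq_trans rhoc; case: (tdeg g) => [|d]; first by rewrite !expn0.
    by rewrite leq_exp2r.
  - rewrite hornerD hornerX hornerC hornerD !hornerC -mpolyCD; exact: feasC.
  - rewrite !hornerC; exact: feasC.
pose f := (mmap2 v G)^`(e).
have fD : bfeas W (D + 3).+3 (3 * (b + (2 * c + 4)) + 11).+2 f.
  by apply: bfeas_derivn; apply: bfeas_mmap2.
have f0 : mult_of 'X f`_0.
  apply: mult0; rewrite -[f`_0]horner_coef0 f_at add0r mod0 Pe0.
  by rewrite meval0 mpolyC0.
have f1 : cong 'X f`_1 (al%:MP : A)%:P.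
  have -> : f`_1 = f^`().[0] by rewrite horner_coef0 coef_deriv mulr1n.
  apply: mult0; rewrite -derivnS f_at add0r hornerD hornerN hornerC mod0.
  by rewrite subrr.
have [Y YD Yroot] := root_circuit char0 W2 fD (ltn0Sn (tdeg g)) dc al0 f0 f1.
have {}Yroot : cong 'X^((tdeg g).+1) Y (s g - y1).
  apply: Yroot.
    by apply: mult0; rewrite hornerD hornerN hornerC along_line0 subrr.
  rewrite f_at subrK horner_map /= Pe0 rmorph0; exact: mult_of0.
(* Along the line g has T-degree at most deg g, so Y modulo T^(deg g + 1) determines it. At T = 1
   the line reaches the generic point, whence a plain sum of coefficients. *)
have gE : g = (g.@[a])%:MP + \sum_(j < (tdeg g).+1) Y`_j.
  rewrite -[LHS](along_line1 a) (horner_coef_wide _ (size_along_line a g)).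
  have /mult_of_XnP YE := Yroot.
  have coefE (j : 'I_(tdeg g).+1) : (s g)`_j = y1`_j + Y`_j.
    have /eqP := YE j (ltn_ord j).
    by rewrite coefB coefB subr_eq0 => /eqP ->; rewrite addrC subrK.
  under eq_bigr => j _ do rewrite expr1n mulr1 coefE.
  rewrite big_split /=; congr (_ + _).
  by rewrite big_ord_recl coefC /= big1 ?addr0 // => j _; rewrite coefC.
rewrite gE; have -> : (D + 27 = ((D + 3).+3 + 19).+2)%N by lia.
have -> : rdeg = (c + (729 * ((3 * (b + (2 * c + 4)) + 11).+2 + 8) + 252 * c)).+3.
  by rewrite /rdeg; lia.
apply: feasD => //; first exact: feasC.
apply: feas_sum => // [|j]; first by rewrite size_index_enum card_ord.
by have [_ /(_ j 0%N)] := YD; rewrite coefC.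
Qed.

End KIRoot.

(** * Translation to iterated polynomials *)

Section Translation.
Context (F : fieldType) (n : nat).
Let A : comNzRingType := {mpoly F[n]}.

Definition Txz_arg (i : 'I_n.+2) : {poly {poly A}} :=
  if unlift ord0 i is Some i' then
    if unlift ord_max i' is Some j then ('X_j : A)%:P%:P else 'X
  else 'X%:P.

Definition Tx_arg (i : 'I_n.+1) : {poly A} :=
  if unlift ord0 i is Some j then ('X_j : A)%:P else 'X.

(* F[T, x, z] as F[x][T][z] and F[T, x] as F[x][T]. *)
Definition Txz (P : {mpoly F[n.+2]}) : {poly {poly A}} :=
  mmap (polyC \o polyC \o @mpolyC n F) Txz_arg P.

Definition Tx (R : {mpoly F[n.+1]}) : {poly A} :=
  mmap (polyC \o @mpolyC n F) Tx_arg R.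

HB.instance Definition _ :=
  GRing.RMorphism.copy Txz (mmap (polyC \o polyC \o @mpolyC n F) Txz_arg).
HB.instance Definition _ :=
  GRing.RMorphism.copy Tx (mmap (polyC \o @mpolyC n F) Tx_arg).

Lemma lift_max j : lift ord_max j = widen_ord (leqnSn n) j :> 'I_n.+1.
Proof. by apply/val_inj; rewrite /= /bump leqNgt ltn_ord. Qed.

Lemma lift0_max : lift ord0 ord_max = ord_max :> 'I_n.+2.
Proof. exact/val_inj. Qed.

Lemma xindex_neq_max j : (@xindex n j == ord_max) = false.
Proof. by apply: ltn_eqF; rewrite /= /bump /= add1n ltnS ltn_ord. Qed.

Lemma TxzC c : Txz c%:MP = (c%:MP : A)%:P%:P.
Proof. by rewrite /Txz mmapC. Qed.

Lemma TxzT : Txz 'X_ord0 = 'X%:P.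
Proof. by rewrite /Txz mmapX mmap1U /Txz_arg unlift_none. Qed.

Lemma Txzx j : Txz 'X_(xindex j) = ('X_j : A)%:P%:P.
Proof. by rewrite /Txz mmapX mmap1U /Txz_arg /xindex liftK -lift_max liftK. Qed.

Lemma Txzz : Txz 'X_ord_max = 'X.
Proof. by rewrite /Txz mmapX mmap1U /Txz_arg -lift0_max liftK unlift_none. Qed.

Lemma TxC c : Tx c%:MP = (c%:MP : A)%:P.
Proof. by rewrite /Tx mmapC. Qed.

Lemma TxT : Tx 'X_ord0 = 'X.
Proof. by rewrite /Tx mmapX mmap1U /Tx_arg unlift_none. Qed.

Lemma Txx j : Tx 'X_(lift ord0 j) = ('X_j : A)%:P.
Proof. by rewrite /Tx mmapX mmap1U /Tx_arg liftK. Qed.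

Lemma Txz_ext (R : nzRingType) (f g : {rmorphism {mpoly F[n.+2]} -> R}) :
  (forall c, f c%:MP = g c%:MP) -> f 'X_ord0 = g 'X_ord0 ->
  (forall j, f 'X_(xindex j) = g 'X_(xindex j)) -> f 'X_ord_max = g 'X_ord_max ->
  f =1 g.
Proof.
move=> fgC fgT fgx fgz; apply: mpoly_hom_ext => // i.
case: (unliftP ord0 i) => [i' ->|-> //].
by case: (ord_maxP i') => [->|[j ->]]; [rewrite lift0_max|apply: fgx].
Qed.

Lemma Tx_ext (R : nzRingType) (f g : {rmorphism {mpoly F[n.+1]} -> R}) :
  (forall c, f c%:MP = g c%:MP) -> f 'X_ord0 = g 'X_ord0 ->
  (forall j, f 'X_(lift ord0 j) = g 'X_(lift ord0 j)) -> f =1 g.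
Proof.
move=> fgC fgT fgx; apply: mpoly_hom_ext => // i.
by case: (unliftP ord0 i) => [j ->|->].
Qed.

Lemma muni_T : muni ('X_ord0 : {mpoly F[n.+2]}) = ('X_ord0)%:P.
Proof. by rewrite -muni_widen; congr (muni 'X__); apply: val_inj. Qed.

Lemma muni_x j : muni ('X_(xindex j) : {mpoly F[n.+2]}) = ('X_(lift ord0 j))%:P.
Proof. by rewrite -muni_widen; congr (muni 'X__); apply: val_inj. Qed.

Lemma Txz_muni P : Txz P = map_poly Tx (muni P).
Proof.
pose f : {rmorphism {mpoly F[n.+2]} -> {poly {poly A}}} := map_poly Tx \o @muni n.+1 F.
apply: (Txz_ext (f := Txz) (g := f)) => [c||j|]; rewrite /f /=.
- by rewrite TxzC muniC map_polyC /= TxC.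
- by rewrite TxzT muni_T map_polyC /= TxT.
- by rewrite Txzx muni_x map_polyC /= Txx.
- by rewrite Txzz muni_max map_polyX.
Qed.

Lemma Txz_mwiden R : Txz (mwiden R) = (Tx R)%:P.
Proof.
pose f : {rmorphism {mpoly F[n.+1]} -> {poly {poly A}}} := Txz \o @mwiden n.+1 F.
pose g : {rmorphism {mpoly F[n.+1]} -> {poly {poly A}}} := polyC \o Tx.
apply: (Tx_ext (f := f) (g := g)) => [c||j]; rewrite /f /g /=.
- by rewrite mwidenC TxzC TxC.
- by rewrite mwidenXU (_ : widen_ord _ _ = ord0) ?TxzT ?TxT //; apply: val_inj.
- by rewrite mwidenXU (_ : widen_ord _ _ = xindex j) ?Txzx ?Txx //; apply: val_inj.
Qed.

Definition unTxz (f : {poly {poly A}}) : {mpoly F[n.+2]} :=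
  (map_poly (horner_eval ('X_ord0 : {mpoly F[n.+2]})
     \o map_poly (comp_mpoly [tuple 'X_(xindex j) | j < n])) f).['X_ord_max].

Lemma TxzK P : unTxz (Txz P) = P.
Proof.
pose c : {rmorphism {poly A} -> {mpoly F[n.+2]}} :=
  horner_eval ('X_ord0 : {mpoly F[n.+2]})
    \o map_poly (comp_mpoly [tuple 'X_(xindex j) | j < n]).
pose f : {rmorphism {mpoly F[n.+2]} -> {mpoly F[n.+2]}} :=
  horner_eval ('X_ord_max : {mpoly F[n.+2]}) \o map_poly c \o Txz.
have fE p : f p = (map_poly c (Txz p)).['X_ord_max] by [].
apply: (Txz_ext (f := f) (g := idfun)) => [a||j|]; rewrite fE.
- by rewrite TxzC map_polyC hornerC /c /= /horner_eval map_polyC hornerC /= comp_mpolyC.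
- by rewrite TxzT map_polyC hornerC /c /= /horner_eval map_polyX hornerX.
- rewrite Txzx map_polyC hornerC /c /= /horner_eval map_polyC hornerC /=.
  by rewrite comp_mpolyXU -tnth_nth tnth_mktuple.
- by rewrite Txzz map_polyX hornerX.
Qed.

(** A cofactor is pulled back by [unTxz], which is multiplicative and a left inverse of [Txz]. *)
Lemma divides_Txz Q P : divides (Txz Q) (Txz P) <-> divides Q P.
Proof.
split=> -[h hE]; last by exists (Txz h); rewrite hE rmorphM.
exists (unTxz h); rewrite -[LHS]TxzK hE -[in RHS](TxzK Q).
by rewrite /unTxz rmorphM /= hornerM.
Qed.

Lemma approx_root_Txz k P R :
  approx_root k P R -> mult_of 'X^k (Txz P).[Tx R].
Proof.
move=> [h hE]; rewrite Txz_muni horner_map /= hE rmorphM rmorphXn /= TxT.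
by rewrite mulrC; apply: mult_of_self.
Qed.

Lemma monic_Txz P : monic_in_z P -> exists2 c : F, c != 0
  & lead_coef (Txz P) = (c%:MP : A)%:P.
Proof.
move=> [c c0 lc]; exists c => //.
rewrite Txz_muni lead_coef_map_eq; by rewrite lc /= TxC ?polyC_eq0 ?mpolyC_eq0.
Qed.

Lemma T_regularized_Txz P : T_regularized P -> exists p : {poly F},
  map_poly (horner_eval 0) (Txz P) = map_poly (@mpolyC n F) p.
Proof.
move=> [p pE]; exists p.
pose f : {rmorphism {mpoly F[n.+2]} -> {poly A}} :=
  map_poly (horner_eval (0 : A)) \o Txz.
pose t : (n.+2).-tuple {mpoly F[n.+2]} :=
  [tuple if i == ord0 then 0 else 'X_i | i < n.+2].
pose g : {rmorphism {mpoly F[n.+2]} -> {poly A}} := f \o comp_mpoly t.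
have -> : map_poly (horner_eval 0) (Txz P) = g P.
  apply: (Txz_ext (f := f) (g := g)) => [a||j|]; rewrite /g /=.
  - by rewrite comp_mpolyC.
  - rewrite comp_mpolyXU -tnth_nth tnth_mktuple eqxx /f /= TxzT map_polyC /=.
    by rewrite [Txz 0]raddf0 map_poly0 /horner_eval hornerX polyC0.
  - by rewrite comp_mpolyXU -tnth_nth tnth_mktuple.
  - by rewrite comp_mpolyXU -tnth_nth tnth_mktuple.
rewrite /g /= pE /f /= -!horner_map /= Txzz map_polyX -[RHS]comp_polyXr.
rewrite /comp_poly -!map_poly_comp; congr (_.[_]); apply: eq_map_poly => a /=.
by rewrite TxzC map_polyC /= /horner_eval hornerC.
Qed.

Lemma nondegenerate_Txz P R : nondegenerate P R ->
  ((Txz P)^`().[Tx R].[0]).@[fun=> 0] != 0.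
Proof.
rewrite /nondegenerate.
have TxzD : Txz P^`M(ord_max) = (Txz P)^`().
  have DM p q : Txz p^`M(ord_max) = (Txz p)^`() -> Txz q^`M(ord_max) = (Txz q)^`() ->
      Txz (p * q)^`M(ord_max) = (Txz (p * q))^`().
    by move=> pD qD; rewrite mderivM rmorphD !rmorphM /= derivM pD qD.
  have DC c : Txz (c%:MP)^`M(ord_max) = (Txz c%:MP)^`().
    by rewrite mderivC TxzC derivC rmorph0.
  have DX i : Txz ('X_i)^`M(ord_max) = (Txz 'X_i)^`().
    have -> : 'X_i^`M(ord_max) = (i == ord_max)%:R :> {mpoly F[n.+2]}.
      rewrite mderivX mnm1E; case: eqP => [->|_]; last by rewrite scale0r.
      rewrite scale1r -[RHS]mpolyX0; congr 'X_[_]; apply/mnmP => k.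
      by rewrite mnmBE subnn mnm0E.
    rewrite rmorph_nat; case: (unliftP ord0 i) => [i' ->|->]; last first.
      by rewrite TxzT derivC.
    case: (ord_maxP i') => [->|[j ->]]; first by rewrite lift0_max eqxx Txzz derivX.
    by rewrite -/(xindex j) Txzx derivC xindex_neq_max.
  rewrite (mpolyE P); elim/big_ind: _ => [|p q|m _].
  - rewrite -mpolyC0; exact: (DC).
  - by move=> pD qD; rewrite mderivD !rmorphD /= derivD pD qD.
  rewrite -mul_mpolyC; apply: (DM); first exact: (DC).
  rewrite mpolyXE_id; elim/big_ind: _ => [|p q|i _].
  - rewrite -mpolyC1; exact: (DC).
  - exact: (DM).
  elim: (m i) => [|k IH]; first by rewrite expr0 -mpolyC1; exact: (DC).
  rewrite exprS; exact: (DM _ _ (DX i) IH).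
apply: contraNN => /eqP H; apply/eqP.
rewrite -TxzD in H; rewrite -[RHS]H.
pose f : {rmorphism {mpoly F[n.+2]} -> F} :=
  meval (fun=> 0) \o horner_eval (0 : A) \o horner_eval (Tx R) \o Txz.
pose g : {rmorphism {mpoly F[n.+2]} -> F} :=
  meval (fun i => if i == ord_max then R.@[fun=> 0] else 0).
rewrite -[RHS]/(f _) -[LHS]/(g _).
apply: (Txz_ext (f := g) (g := f)) => [a||j|]; rewrite /f /g /= /horner_eval.
- by rewrite mevalC TxzC !hornerC mevalC.
- by rewrite mevalXU TxzT hornerC hornerX meval0.
- rewrite mevalXU Txzx !hornerC mevalXU xindex_neq_max //.
- rewrite mevalXU eqxx Txzz hornerX.
  pose f1 : {rmorphism {mpoly F[n.+1]} -> F} :=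
    meval (fun=> 0) \o horner_eval (0 : A) \o Tx.
  pose g1 : {rmorphism {mpoly F[n.+1]} -> F} := meval (fun=> 0).
  apply: (Tx_ext (f := g1) (g := f1)) => [a||j]; rewrite /f1 /g1 /= /horner_eval.
  + by rewrite mevalC TxC hornerC mevalC.
  + by rewrite mevalXU TxT hornerX meval0.
  + by rewrite mevalXU Txx hornerC mevalXU.
Qed.

Lemma Txz_monomial (m : 'X_{1..n.+2}) : exists a : A,
  Txz 'X_[m] = (a%:P * 'X^(m ord0))%:P * 'X^(m ord_max).
Proof.
exists (\prod_(j < n) 'X_j ^+ m (xindex j)).
rewrite /Txz mmapX /mmap1 big_ord_recl big_ord_recr {1}/Txz_arg unlift_none /=.
rewrite mulrA; congr (_ * _); last by rewrite {1}/Txz_arg liftK unlift_none lift0_max.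
rewrite rmorphM /= rmorphXn /= mulrC; congr (_ * _).
rewrite !rmorph_prod /=; apply: eq_bigr => j _.
by rewrite /xindex /Txz_arg -!lift_max !liftK !rmorphXn.
Qed.

Lemma coef_Txz_truncT k P j : (Txz (truncT k P))`_j = take_poly k (Txz P)`_j.
Proof.
rewrite {2}(mpolyE P) /truncT !rmorph_sum /= !coef_sum raddf_sum /=.
rewrite big_mkcond /=; apply: eq_bigr => m _.
have [a aE] := Txz_monomial m.
rewrite -mul_mpolyC rmorphM /= TxzC aE mulrA -polyCM !coefCM coefXn.
case: (j == m ord_max)%N; rewrite ?mulr1 ?mulr0; last by case: ifP; rewrite ?take_poly0r.
rewrite mulrA -polyCM; case: ltnP => mk.
  rewrite take_poly_id // (leq_trans (size_polyMleq _ _)) // size_polyXn.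
  by have := size_polyC_leq1 ((P@_m)%:MP * a : A); move: (size _%:P) => u; lia.
apply/polyP => i; rewrite coef_take_poly coef0 coefCM coefXn.
by case: ltnP => // ik; rewrite ltn_eqF ?mulr0 // (leq_trans ik).
Qed.

Lemma coef_Txz_Qpoly k l (R : 'I_l -> {mpoly F[n.+1]}) j :
  (Txz (Qpoly k R))`_j = take_poly k (\prod_(i < l) ('X - (Tx (R i))%:P))`_j.
Proof.
rewrite coef_Txz_truncT; suff -> : Txz (\prod_(i < l) ('X_ord_max - mwiden (R i)))
  = \prod_(i < l) ('X - (Tx (R i))%:P) by [].
rewrite rmorph_prod; apply: eq_bigr => i _.
by rewrite rmorphB /= Txzz Txz_mwiden.
Qed.

End Translation.

(** In F[x][T][z], substituting for x is a change of coefficient ring that leaves T and z alone, so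
    congruences modulo powers of T survive it. *)
Lemma Txz_subst_x (F : fieldType) n mu (h : 'I_n -> {mpoly F[mu]}) P :
  Txz (subst_x h P)
    = map_poly (map_poly (comp_mpoly [tuple h i | i < n])) (Txz P).
Proof.
pose c : {rmorphism {mpoly F[n]} -> {mpoly F[mu]}} := comp_mpoly [tuple h i | i < n].
pose t : (n.+2).-tuple {mpoly F[mu.+2]} := [tuple of 'X_ord0
   :: rcons [tuple h i \mPo [tuple 'X_(xindex j) | j < mu] | i < n] 'X_ord_max].
pose f : {rmorphism {mpoly F[n.+2]} -> {poly {poly {mpoly F[mu]}}}} :=
  @Txz F mu \o comp_mpoly t.
pose g : {rmorphism {mpoly F[n.+2]} -> {poly {poly {mpoly F[mu]}}}} :=
  map_poly (map_poly c) \o @Txz F n.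
apply: (Txz_ext (f := f) (g := g)) => [a||j|]; rewrite /f /g /=.
- by rewrite comp_mpolyC !TxzC !map_polyC /= map_polyC /= comp_mpolyC.
- by rewrite comp_mpolyXU /= !TxzT map_polyC /= map_polyX.
- rewrite comp_mpolyXU /= add0n nth_rcons size_map size_enum_ord ltn_ord.
  rewrite (nth_map j) ?size_enum_ord // nth_ord_enum Txzx !map_polyC /= map_polyC /=.
  rewrite comp_mpolyXU -tnth_nth tnth_mktuple.
  pose f1 : {rmorphism {mpoly F[mu]} -> {poly {poly {mpoly F[mu]}}}} :=
    @Txz F mu \o comp_mpoly [tuple 'X_(xindex j) | j < mu].
  pose g1 : {rmorphism {mpoly F[mu]} -> {poly {poly {mpoly F[mu]}}}} :=
    polyC \o polyC.
  apply: (mpoly_hom_ext (f := f1) (g := g1)) => [a|i]; rewrite /f1 /g1 /=.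
    by rewrite comp_mpolyC TxzC.
  by rewrite comp_mpolyXU -tnth_nth tnth_mktuple Txzx.
- by rewrite comp_mpolyXU /= nth_rcons size_map size_enum_ord ltnn eqxx !Txzz map_polyX.
Qed.

Section PolynomialCongruences.
Context (B : comNzRingType) (t : B).
Implicit Types (p q : {poly B}).

Lemma cong_polyP p q : cong_poly t p q <-> cong t%:P p q.
Proof.
split=> [pq|[h pq] j]; last first.
  by rewrite /cong -coefB pq coefCM; apply: mult_of_self.
have {}pq j : mult_of t (p - q)`_j by rewrite coefB; apply: pq.
rewrite /cong; move: (p - q) pq; elim/poly_ind => [|f c IH] H; first exact: mult_of0.
have [j|h ->] := IH; first by have := H j.+1; rewrite coefD coefMX coefC addr0.
have [d] := H 0%N; rewrite coefD coefMX coefC add0r /= => ->.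
by exists (h * 'X + d%:P); rewrite polyCM; ring.
Qed.

Lemma cong_poly_linear (I : Type) (r : seq I) (R R' : I -> B) :
  (forall i, cong t (R i) (R' i)) ->
  cong_poly t (\prod_(i <- r) ('X - (R i)%:P)) (\prod_(i <- r) ('X - (R' i)%:P)).
Proof.
move=> RR; apply/cong_polyP/cong_prod => i _; apply: congB; first exact: cong_refl.
by have [h hE] := RR i; exists h%:P; rewrite -polyCB hE polyCM.
Qed.

Lemma cong_poly_trans q p f : cong_poly t p q -> cong_poly t q f -> cong_poly t p f.
Proof. by move=> pq qf j; apply: cong_trans (pq j) (qf j). Qed.

Lemma cong_poly_sym p q : cong_poly t p q -> cong_poly t q p.
Proof. by move=> pq j; apply: cong_sym. Qed.

End PolynomialCongruences.

Lemma mult_of_X0P (A : comNzRingType) (p : {poly A}) : mult_of 'X p <-> p.[0] = 0.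
Proof.
rewrite -['X]expr1 mult_of_XnP horner_coef0; split=> [|p0 [|//]] // p0.
exact: p0.
Qed.

Lemma size_prod_linear (B : comNzRingType) l (R : 'I_l -> B) :
  size (\prod_(i < l) ('X - (R i)%:P)) = l.+1.
Proof. by rewrite size_prod_XsubC size_index_enum card_ord. Qed.

Lemma mult_of_X_pow (B : comNzRingType) (t x : B) m :
  (0 < m)%N -> mult_of (t ^+ m) x -> mult_of t x.
Proof. by case: m => // m _ [h ->]; exists (t ^+ m * h); rewrite exprS mulrA. Qed.

Section RootData.
Context (F : fieldType) (n : nat).
Let A : comNzRingType := {mpoly F[n]}.
Context (k : nat) (k1 : (1 < k)%N) (P : {mpoly F[n.+2]}).
Context (Preg : T_regularized P) (Pmon : monic_in_z P).

(** At T = 0, P becomes some p in F[z], nonzero as P is monic, and R(0, x) is a root of p: being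
    algebraic over F, it is a constant r. Then al = p'(r) is free of x as well, and nonzero by
    nondegeneracy. *)
Lemma root_data (R : {mpoly F[n.+1]}) :
  nondegenerate P R -> approx_root k P R ->
  exists r al : F, [/\ (Tx R).[0] = r%:MP, al != 0,
    (Txz P).[((r%:MP : A))%:P].[0] = 0 &
    forall x : {poly A}, x.[0] = r%:MP -> (Txz P)^`().[x].[0] = al%:MP].
Proof.
move=> Rnd Rroot; have [p pE] := T_regularized_Txz Preg.
pose ev0 : {rmorphism {poly A} -> A} := horner_eval 0.
have at0 (f : {poly {poly A}}) x : f.[x].[0] = (map_poly ev0 f).[x.[0]].
  by rewrite -[x.[0]]/(ev0 x) horner_map.
have p0 : p != 0.
  have [c c0 lc] := monic_Txz Pmon.
  apply: contraNneq c0 => p0; move: pE; rewrite p0 map_poly0.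
  move=> /(congr1 (fun f : {poly A} => f`_(size (Txz P)).-1)); rewrite coef0.
  rewrite (@coef_map _ _ ev0) /= -lead_coefE lc /horner_eval hornerC.
  by move/eqP; rewrite mpolyC_eq0.
have [r rE] : exists r, (Tx R).[0] = r%:MP.
  apply: (@algebraic_const _ _ _ p p0); rewrite -pE -at0; apply/mult_of_X0P.
  exact: mult_of_X_pow (ltnW k1) (approx_root_Txz Rroot).
have d0 x : x.[0] = r%:MP -> (Txz P)^`().[x].[0] = (p^`().[r])%:MP.
  move=> x0; rewrite at0 x0 -deriv_map pE deriv_map.
  by rewrite (horner_map (@mpolyC n F)).
exists r, (p^`().[r]); split=> //.
  have := nondegenerate_Txz Rnd; rewrite d0 // mevalC.
  by [].
rewrite at0 hornerC -rE -at0; apply/mult_of_X0P.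
exact: mult_of_X_pow (ltnW k1) (approx_root_Txz Rroot).
Qed.

End RootData.

(** * Lifted roots of P *)

Section LiftedRoots.
Context (F : fieldType) (char0 : [pchar F] =i pred0) (n : nat).
Let A : comNzRingType := {mpoly F[n]}.
Context (k : nat) (k1 : (1 < k)%N) (P : {mpoly F[n.+2]}).
Context (Preg : T_regularized P) (Pmon : monic_in_z P).

Definition const_poly (r : F) : {poly A} := (r%:MP : A)%:P.

Lemma const_polyV (al : F) : al != 0 -> const_poly al * const_poly al^-1 = 1.
Proof. by move=> al0; rewrite /const_poly -polyCM -mpolyCM mulfV. Qed.

(* r and al are the values at T = 0 of the root and of the derivative of P. *)
Lemma lifted_root M (R : {mpoly F[n.+1]}) : (k <= M)%N ->
  nondegenerate P R -> approx_root k P R ->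
  exists rar : F * F * {poly A}, let: (r, al, Rh) := rar in
  [/\ al != 0, Rh.[0] = r%:MP, cong 'X^k Rh (Tx R), mult_of 'X^M (Txz P).[Rh] &
      (Txz P).[const_poly r].[0] = 0 /\
      forall x : {poly A}, x.[0] = r%:MP -> (Txz P)^`().[x].[0] = al%:MP].
Proof.
move=> kM Rnd Rroot.
have [r [al [rE al0 Pr0 Pd]]] := root_data k1 Preg Pmon Rnd Rroot.
have albe := const_polyV al0.
have PRal : cong 'X (Txz P)^`().[Tx R] (const_poly al).
  by apply/mult_of_X0P; rewrite hornerD hornerN hornerC Pd ?subrr.
have [Rh RhR PRh] := hensel (ltnW k1) kM albe PRal (approx_root_Txz Rroot).
exists (r, al, Rh); split=> //.
have /mult_of_X0P : mult_of 'X (Rh - Tx R) by apply: mult_of_X_pow (ltnW k1) RhR.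
by rewrite hornerD hornerN rE => /eqP; rewrite subr_eq0 => /eqP.
Qed.

End LiftedRoots.

Section LiftedRootCircuit.
Context (F : fieldType) (char0 : [pchar F] =i pred0) (n : nat).
Let A : comNzRingType := {mpoly F[n]}.
Context (P : {mpoly F[n.+2]}).
Context (W : nat) (W2 : (1 < W)%N) (D b c : nat) (PD : feas W D b P).

(** Shifting z by r makes the root vanish at T = 0. At scalar T and z each argument of P is then a
    scalar or a variable, which costs no edges or levels. *)
Lemma lifted_root_circuit M (r al : F) : (0 < M)%N -> (M <= W ^ c)%N -> al != 0 ->
  (Txz P).[const_poly n r].[0] = 0 ->
  (Txz P)^`().[const_poly n r].[0] = al%:MP ->
  exists2 Y : {poly A}, bfeas W (D + 21) (729 * (3 * b + 19) + 252 * c) Y%:P &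
  forall Rh, Rh.[0] = r%:MP -> mult_of 'X^M (Txz P).[Rh] ->
    cong 'X^M Y (Rh - const_poly n r).
Proof.
move=> M0 Mc al0 Pr Pd.
pose q : {poly {poly A}} := 'X + (const_poly n r)%:P.
pose v i := Txz_arg F i \Po q.
have vC a : (a%:P : {poly {poly A}}) \Po q = a%:P by rewrite comp_polyC.
have vcase (K : {poly {poly A}} -> Prop) : K 'X%:P ->
    (forall j, K ('X_j : A)%:P%:P) -> K q -> forall i, K (v i).
  move=> H1 H2 H3 i; rewrite /v /Txz_arg; case: unliftP => [i' _|_]; last by rewrite vC.
  case: unliftP => [j _|_]; first by rewrite vC; exact: H2.
  rewrite comp_polyX; exact: H3.
have fE : mmap2 v P = Txz P \Po q.
  pose f1 : {rmorphism {mpoly F[n.+2]} -> {poly {poly A}}} :=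
    mmap (polyC \o polyC \o @mpolyC n F) v.
  pose f2 : {rmorphism {mpoly F[n.+2]} -> {poly {poly A}}} :=
    comp_poly q \o @Txz F n.
  apply: (mpoly_hom_ext (f := f1) (g := f2)) => [a|i]; rewrite /f1 /f2 /=.
    by rewrite mmapC TxzC vC.
  by rewrite /Txz !mmapX !mmap1U.
have fD : bfeas W (D + 0).+2 (3 * (b + 0) + 11) (mmap2 v P).
  apply: bfeas_mmap2 => //.
    apply: vcase => [|j|]; rewrite ?expn0; [exact: boxXC|exact: box_const|].
    by apply: boxD; [exact: boxX|exact: box_const].
  move=> i c1 c2; move: i.
  apply: (vcase (fun x => feas W 0 0 (eval2 c1 c2 x : {mpoly F[n]}))) => [|j|]; rewrite /eval2.
  - rewrite hornerC hornerX; exact: feasC.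
  - rewrite !hornerC; exact: feasX.
  - rewrite hornerD hornerX hornerC hornerD !hornerC -mpolyCD; exact: feasC.
have f_at y : (mmap2 v P).[y] = (Txz P).[y + const_poly n r].
  by rewrite fE horner_comp hornerD hornerX hornerC.
have f0 : mult_of 'X (mmap2 v P)`_0.
  by rewrite -horner_coef0 f_at add0r; apply/mult_of_X0P.
have f1 : cong 'X (mmap2 v P)`_1 (al%:MP : A)%:P.
  have -> : (mmap2 v P)`_1 = (mmap2 v P)^`().[0].
    by rewrite horner_coef0 coef_deriv mulr1n.
  rewrite fE deriv_comp derivD derivX derivC addr0 mulr1 horner_comp.
  rewrite hornerD hornerX hornerC add0r; apply/mult_of_X0P.
  by rewrite hornerD hornerN hornerC Pd subrr.
have [Y YD Yroot] := root_circuit char0 W2 fD M0 Mc al0 f0 f1.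
exists Y.
  by apply: (bfeas_mono W2 _ _ YD); lia.
move=> Rh Rh0 PRh; apply: Yroot; last by rewrite f_at subrK.
by apply/mult_of_X0P; rewrite hornerD hornerN hornerC Rh0 subrr.
Qed.

End LiftedRootCircuit.

Section Extend.
Context (T : Type) (l : nat).

(** Inductions on l want families indexed by nat; the default is never reached below l. *)
Definition extend (f : 'I_l -> T) (d : T) (i : nat) : T :=
  if insub i is Some i' then f i' else d.

Lemma extendE f d (i : 'I_l) : extend f d i = f i.
Proof. by rewrite /extend valK. Qed.

End Extend.

Lemma prod_extend (B : comNzRingType) l (R : 'I_l -> B) :
  \prod_(i < l) ('X - (extend R 0 i)%:P) = \prod_(i < l) ('X - (R i)%:P).
Proof. by apply: eq_bigr => i _; rewrite extendE. Qed.

Lemma unit_mod_sub (F : fieldType) n (x y : {poly {mpoly F[n]}}) (r r' : F) :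
  x.[0] = r%:MP -> y.[0] = r'%:MP -> r != r' -> unit_mod 'X (x - y).
Proof.
move=> x0 y0 rr; exists (((r - r')^-1)%:MP)%:P; apply/mult_of_X0P.
rewrite hornerD hornerN hornerM hornerD hornerN !hornerC x0 y0.
by rewrite -mpolyCB -mpolyCM mulfV ?subr_eq0 // subrr.
Qed.

Lemma unit_mod_extend (F : fieldType) n l (x : 'I_l -> {poly {mpoly F[n]}}) (r : 'I_l -> F) :
  (forall i, (x i).[0] = (r i)%:MP) -> (forall i j, i != j -> r i != r j) ->
  forall i j, (i < l)%N -> (j < l)%N -> i != j ->
    unit_mod 'X (extend x 0 i - extend x 0 j).
Proof.
move=> x0 rr i j il jl ij; rewrite /extend !insubT /=.
by apply: (unit_mod_sub (x0 _) (x0 _)); apply: rr.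
Qed.

Section SubstitutedCongruences.
Context (A A' : comNzRingType) (h : {rmorphism A -> A'}).

Lemma map_poly_at0 (x : {poly A}) : (map_poly h x).[0] = h x.[0].
Proof. by rewrite -(rmorph0 h) horner_map. Qed.

Lemma mult_of_map M (x : {poly A}) :
  mult_of 'X^M x -> mult_of 'X^M (map_poly h x).
Proof. by move=> [y ->]; exists (map_poly h y); rewrite rmorphM /= map_polyXn. Qed.

Lemma cong_poly_map M (p q : {poly {poly A}}) : cong_poly 'X^M p q ->
  cong_poly 'X^M (map_poly (map_poly h) p) (map_poly (map_poly h) q).
Proof.
move=> pq j; rewrite !coef_map /cong -rmorphB; apply: mult_of_map; exact: pq.
Qed.

Lemma map_prod_linear l (R : 'I_l -> {poly A}) :
  map_poly (map_poly h) (\prod_(i < l) ('X - (R i)%:P))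
    = \prod_(i < l) ('X - (map_poly h (R i))%:P).
Proof.
rewrite rmorph_prod; apply: eq_bigr => i _.
by rewrite rmorphB /= map_polyX map_polyC.
Qed.

End SubstitutedCongruences.

Section TruncatedProduct.
Context (F : fieldType) (n k l : nat) (k1 : (1 < k)%N).
Context (R : 'I_l -> {mpoly F[n.+1]}).
Let A : comNzRingType := {mpoly F[n]}.

Lemma Qpoly_cong (Rh : 'I_l -> {poly A}) :
  (forall i, cong 'X^k (Rh i) (Tx (R i))) ->
  cong_poly 'X^k (Txz (Qpoly k R)) (\prod_(i < l) ('X - (Rh i)%:P)).
Proof.
move=> RhR; apply: cong_poly_trans (cong_poly_sym (cong_poly_linear _ RhR)).
move=> j; rewrite coef_Txz_Qpoly; apply/mult_of_XnP => i ik.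
by rewrite coefB coef_take_poly ik subrr.
Qed.

Lemma Qpoly_monic : [/\ Txz (Qpoly k R) \is monic, size (Txz (Qpoly k R)) = l.+1
  & forall j, (size ((Txz (Qpoly k R))`_j)%R <= k)%N].
Proof.
set p := \prod_(i < l) ('X - (Tx (R i))%:P).
have pmon : p \is monic by apply: monic_prod_XsubC.
have sp : size p = l.+1 := size_prod_linear _.
have Ql : (Txz (Qpoly k R))`_l = 1.
  rewrite coef_Txz_Qpoly -/p; have := monicP pmon; rewrite lead_coefE sp /= => ->.
  by rewrite take_poly_id // size_poly1 ltnW.
have sQ : size (Txz (Qpoly k R)) = l.+1.
  apply/eqP; rewrite eqn_leq; apply/andP; split.
    apply/leq_sizeP => j lj; rewrite coef_Txz_Qpoly -/p nth_default ?sp //.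
    exact: take_poly0r.
  by rewrite ltnNge; apply/negP => /leq_sizeP/(_ l (leqnn l))/eqP; rewrite Ql oner_eq0.
split=> // [|j]; first by rewrite monicE lead_coefE sQ Ql.
by rewrite coef_Txz_Qpoly size_take_poly.
Qed.

End TruncatedProduct.

(** * The witness coefficient *)

Lemma coef_coef_Xn (B : nzRingType) l e j : (0 < j)%N ->
  ('X^l : {poly {poly B}})`_e`_j = 0.
Proof.
move=> j0; rewrite coefXn; case: (e == l)%N => /=; last by rewrite coef0.
by rewrite coef1 gtn_eqF.
Qed.

(** Modulo t, f is (z - R i)(z - R j) times a polynomial; if the two roots agree modulo t, the
    derivative vanishes there. This is what forces the r i to be distinct. *)
Lemma double_root (B : comNzRingType) (t : B) l (R : 'I_l -> B) (f Q H : {poly B}) :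
  f = H * Q -> cong_poly t Q (\prod_(i < l) ('X - (R i)%:P)) ->
  forall i j, i != j -> mult_of t (R i - R j) -> mult_of t f^`().[R i].
Proof.
move=> fE /cong_polyP QR i j ij [d dE]; move: QR.
rewrite (bigD1 i) //= (bigD1 j) 1?eq_sym //=; set q := \prod_(_ < _ | _) _.
move=> [u /eqP]; rewrite subr_eq => /eqP Qu.
have -> : f = t%:P * (H * u)
    + ('X - (R i)%:P) * (('X - (R j)%:P) * (H * q)).
  by rewrite fE Qu; ring.
move: (H * u) (H * q) => v w.
rewrite derivD derivM derivC mul0r add0r derivM derivB derivX derivC subr0 mul1r.
rewrite !(hornerD, hornerM, hornerC, hornerX, hornerN) subrr mul0r addr0 dE.
exists (v^`().[R i] + d * w.[R i]); ring.
Qed.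

Lemma size_monic_sub (B : nzRingType) l (p q : {poly B}) :
  p \is monic -> q \is monic -> size p = l.+1 -> size q = l.+1 ->
  (size (p - q)%R <= l)%N.
Proof.
move=> /monicP pm /monicP qm sp sq; apply/leq_sizeP => j.
rewrite leq_eqVlt coefB => /predU1P[<-|lj]; last first.
  by rewrite !nth_default ?sp ?sq // subrr.
by move: pm qm; rewrite !lead_coefE sp sq /= => -> ->; rewrite subrr.
Qed.

Section Witness.
Context (F : fieldType) (char0 : [pchar F] =i pred0) (n k l : nat) (k1 : (1 < k)%N).
Context (P : {mpoly F[n.+2]}) (R : 'I_l -> {mpoly F[n.+1]}).
Context (Preg : T_regularized P) (Pmon : monic_in_z P).
Context (PR : forall i, [/\ truncated k (R i), nondegenerate P (R i)
                          & approx_root k P (R i)]).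
Let A : comNzRingType := {mpoly F[n]}.

(** Larger than the T-degree of the remainder of P by Q: the T-degree is at most deg P at the start,
    and each of at most deg P + 1 division steps adds less than k. *)
Definition lift_order : nat := (tdeg P + (tdeg P).+1 * k).+1.
Local Notation M := lift_order.

Lemma le_k_lift_order : (k <= M)%N.
Proof. by rewrite /lift_order; nia. Qed.

Lemma Txz_bounds : (size (Txz P) <= (tdeg P).+1)%N /\
  forall j, (size ((Txz P)`_j)%R <= (tdeg P).+1)%N.
Proof.
have := box_mmap2 (v := @Txz_arg F n) (B := 1) P; rewrite muln1; apply=> i.
rewrite /Txz_arg; case: unliftP => [i' _|_]; last exact: boxXC.
by case: unliftP => [j _|_]; [exact: box_const|exact: boxX].
Qed.

Context (mu : nat) (hf : 'I_n -> {mpoly F[mu]}).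
Let h : {rmorphism A -> {mpoly F[mu]}} := comp_mpoly [tuple hf i | i < n].

Lemma divides_subst_x (Q : {mpoly F[n.+2]}) :
  divides (subst_x hf Q) (subst_x hf P) ->
  exists H, map_poly (map_poly h) (Txz P) = H * map_poly (map_poly h) (Txz Q).
Proof.
move=> [H /(congr1 (@Txz F mu))]; rewrite rmorphM /= !Txz_subst_x => PH.
by exists (Txz H).
Qed.

(** Divisibility after the substitution is enough, because r i and al i are scalars and no
    substitution for x changes them. *)
Lemma divides_distinct_roots (r al : 'I_l -> F) (Rh : 'I_l -> {poly A}) :
  divides (subst_x hf (Qpoly k R)) (subst_x hf P) ->
  (forall i, cong 'X^k (Rh i) (Tx (R i))) ->
  (forall i, (Rh i).[0] = (r i)%:MP) ->
  (forall i, al i != 0) ->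
  (forall i, (Txz P)^`().[Rh i].[0] = (al i)%:MP) ->
  forall i j, i != j -> r i != r j.
Proof.
move=> /divides_subst_x[H PH] RhR Rh0 al0 Pd i j ij.
apply: contraNneq (al0 i) => rij.
have QR : cong_poly 'X (map_poly (map_poly h) (Txz (Qpoly k R)))
    (\prod_(i < l) ('X - (map_poly h (Rh i))%:P)).
  rewrite -map_prod_linear => e; apply: mult_of_X_pow (ltnW k1) _.
  exact: (cong_poly_map h (Qpoly_cong RhR) e).
have ab : mult_of 'X (map_poly h (Rh i) - map_poly h (Rh j)).
  apply/mult_of_X0P; rewrite hornerD hornerN !map_poly_at0 !Rh0 rij.
  exact: subrr.
have /mult_of_X0P := double_root PH QR ij ab.
rewrite deriv_map (horner_map (map_poly h)) map_poly_at0 Pd /h /= comp_mpolyC.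
by move/eqP; rewrite mpolyC_eq0.
Qed.

(** G is fixed before W, D, b and c, so it also serves the case rho = 1. The last clause rules out P
    computable in depth 0. *)
Lemma witness : ~ divides (Qpoly k R) P ->
  divides (subst_x hf (Qpoly k R)) (subst_x hf P) ->
  exists G : {mpoly F[n]}, [/\ G != 0, G \mPo [tuple hf i | i < n] = 0 &
    forall W D b c, (1 < W)%N -> feas W D b P -> (l <= W ^ c)%N ->
      (M <= W ^ c)%N ->
      feas W (D + 29) (9 * (729 * (3 * b + 19) + 252 * c + 6) + 3 * c + 23) G] /\
    ~ ((exists a, Txz P = a%:P) \/ Txz P = 'X).
Proof.
move=> Qndiv Qdiv.
have /fin_all_exists[rar rarP] i : exists x : F * F * {poly A},
    [/\ x.1.2 != 0, x.2.[0] = x.1.1%:MP, cong 'X^k x.2 (Tx (R i)),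
        mult_of 'X^M (Txz P).[x.2] &
        (Txz P).[const_poly n x.1.1].[0] = 0 /\
        forall y : {poly A}, y.[0] = x.1.1%:MP -> (Txz P)^`().[y].[0] = x.1.2%:MP].
  have [_ Rnd Rroot] := PR i.
  have [[[r al] Rh] H] := lifted_root k1 Preg Pmon le_k_lift_order Rnd Rroot.
  by exists (r, al, Rh).
pose r i := (rar i).1.1; pose al i := (rar i).1.2; pose Rh i := (rar i).2.
have al0 i : al i != 0 by case: (rarP i).
have Rh0 i : (Rh i).[0] = (r i)%:MP by case: (rarP i).
have RhR i : cong 'X^k (Rh i) (Tx (R i)) by case: (rarP i).
have PRh i : mult_of 'X^M (Txz P).[Rh i] by case: (rarP i).
have Pr i : (Txz P).[const_poly n (r i)].[0] = 0 by case: (rarP i) => _ _ _ _ [].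
have Pd i x : x.[0] = (r i)%:MP -> (Txz P)^`().[x].[0] = (al i)%:MP.
  by case: (rarP i) => _ _ _ _ []; auto.
have rdist := divides_distinct_roots Qdiv RhR Rh0 al0 (fun i => Pd i _ (Rh0 i)).
pose Pi := \prod_(i < l) ('X - (Rh i)%:P).
have [monQ sQ cQ] := Qpoly_monic k1 R.
have QPi : cong_poly 'X^k (Txz (Qpoly k R)) Pi := Qpoly_cong RhR.
have [sP cP] := Txz_bounds.
(* If all these coefficients vanished, Q would agree with Pi modulo T^M: below T^k by construction,
   and from T^k on because Q has no terms there. Then Q would divide P. *)
have [e [j [/andP[kj jM] G0]]] : exists e j, (k <= j < M)%N /\ Pi`_e`_j != 0.
  apply: Classical_Prop.NNPP => noG; apply: Qndiv; apply/divides_Txz.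
  apply: (divides_of_roots (M := M) (l := l) (a := tdeg P) (b := k.-1)
    (R := extend Rh 0)) => //.
  - by rewrite prednK // ltnW.
  - rewrite /lift_order ltnS leq_add2l leq_mul //; exact: leq_pred.
  - move=> i il; rewrite /extend insubT; exact: PRh.
  - exact: unit_mod_extend.
  rewrite prod_extend => e; apply/mult_of_XnP => j jM.
  have [jk|kj] := ltnP j k; first by have /mult_of_XnP := QPi e; apply.
  rewrite coefB [X in X - _]nth_default ?(leq_trans (cQ e)) // sub0r.
  apply/eqP; rewrite oppr_eq0; apply: contraT => ne; case: noG.
  by exists e, j; rewrite kj jM.
exists Pi`_e`_j; split; last first.
  (* A polynomial free of z has no simple root, and a lifted root of z is 0 modulo T^M. So Pi would
     be z^l modulo T^M, which has no term in T^j for j >= k. *)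
  move=> Ptriv; have Rh_small i : cong 'X^M (Rh i) 0.
    rewrite /cong subr0; have := PRh i; case: Ptriv => [[a PE]|->]; last by rewrite hornerX.
    have := Pd i _ (Rh0 i); rewrite PE derivC !horner0 => /esym/eqP.
    by rewrite mpolyC_eq0 (negPf (al0 i)).
  have /mult_of_XnP/(_ j jM)/eqP := cong_poly_linear (index_enum _) Rh_small e.
  rewrite coefB subr_eq0 -/Pi => /eqP PiE; move: G0; rewrite PiE.
  have -> : \prod_(i < l) ('X - 0%:P) = 'X^l :> {poly {poly A}}.
    by rewrite polyC0 subr0 prodr_const card_ord.
  by rewrite coef_coef_Xn ?eqxx // (leq_trans _ kj) // ltnW.
split=> //.
  pose al' := extend (fun i => const_poly mu (al i)) 0.
  pose be' := extend (fun i => const_poly mu (al i)^-1) 0.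
  pose phi : {rmorphism {poly A} -> {poly {mpoly F[mu]}}} := map_poly h.
  pose R' := extend (fun i => phi (Rh i)) 0.
  have [H PH] := divides_subst_x Qdiv.
  have phiRh0 i : (phi (Rh i)).[0] = (r i)%:MP.
    by rewrite /phi /= map_poly_at0 Rh0 /h /= comp_mpolyC.
  have Q'Pi : cong_poly 'X^k (map_poly (map_poly h) (Txz (Qpoly k R)))
      (\prod_(i < l) ('X - (R' i)%:P)).
    rewrite prod_extend -map_prod_linear; exact: cong_poly_map.
  (* The image of Q divides that of P, hence agrees with the image of Pi modulo T^M. Its T-degree is
     below k, so its coefficient at T^j is 0, and so is G after the substitution. *)
  have /(_ e)/mult_of_XnP/(_ j jM) : cong_poly 'X^M (map_poly (map_poly h) (Txz (Qpoly k R)))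
      (\prod_(i < l) ('X - (R' i)%:P)).
    apply: (factor_roots (M := M) (al := al') (be := be') _ PH) => //.
    - move=> i il; rewrite /R' /al' /be' /extend !insubT /=; set io := Sub i il.
      split.
      + rewrite (horner_map phi); exact: mult_of_map (PRh io).
      + apply/mult_of_X0P; rewrite deriv_map (horner_map phi) /= hornerD hornerN.
        by rewrite map_poly_at0 (Pd io) // hornerC /h /= comp_mpolyC subrr.
      + exact: const_polyV.
    - exact: unit_mod_extend.
    - rewrite prod_extend.
      apply: size_monic_sub; rewrite ?size_prod_linear ?monic_prod_XsubC //.
        exact: monic_map.
      by rewrite size_map_poly_id0 // (monicP monQ) rmorph1 oner_neq0.
    - move=> i; apply: mult_of_X_pow (ltnW k1) (Q'Pi i).
  rewrite prod_extend -map_prod_linear -/Pi !coef_map coefB !coef_map /=.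
  rewrite [X in comp_mpoly _ X - _]nth_default ?(leq_trans (cQ e)) // comp_mpoly0 sub0r.
  by move/eqP; rewrite oppr_eq0 => /eqP.
move=> W D b c W2 PD lc Mc.
have /fin_all_exists2[Y YD Yroot] i := lifted_root_circuit char0 W2 PD
  (ltn0Sn _) Mc (al0 i) (Pr i) (Pd i (const_poly n (r i)) (hornerC _ _)).
(* Only coefficients at T^j with j < M matter, so each lifted root may be replaced by r i + Y i. *)
pose ZY i : {poly {poly A}} := 'X + scalar2 n (-1) * (scalar2 n (r i) + (Y i)%:P).
have -> : Pi`_e`_j = (\prod_(i < l) ZY i)`_e`_j.
  have RY i : cong 'X^M (Rh i) (const_poly n (r i) + Y i).
    have /cong_sym[u uE] := Yroot i _ (Rh0 i) (PRh i).
    by exists u; rewrite -uE; ring.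
  have /mult_of_XnP/(_ j jM)/eqP := cong_poly_linear (index_enum _) RY e.
  rewrite coefB subr_eq0 => /eqP ->.
  suff -> : \prod_(i < l) ZY i = \prod_(i < l) ('X - (const_poly n (r i) + Y i)%:P).
    by [].
  by apply: eq_bigr => i _; rewrite /ZY scalar2N1 polyCD.
have ZYD i : bfeas W (D + 24) (729 * (3 * b + 19) + 252 * c + 6) (ZY i).
  have -> : (D + 24 = (D + 21).+3)%N by lia.
  have -> : (729 * (3 * b + 19) + 252 * c + 6 = (729 * (3 * b + 19) + 252 * c).+2.+2.+2)%N by lia.
  apply: bfeasD => //; first exact: bfeasX.
  apply: bfeasZ => //; apply: bfeasD => //; exact: bfeas_scalar.
have lc' : (size (index_enum 'I_l) <= W ^ c)%N.
  by rewrite size_index_enum card_ord.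
have [_ H] := bfeas_prod char0 W2 lc' ZYD.
by have := H j e; rewrite -addnA.
Qed.

End Witness.

(** * Boundary cases and the final bounds *)

Lemma computable_depth0 (F : fieldType) N (p : {mpoly F[N]}) s :
  computable p 0 s -> (exists c, p = c%:MP) \/ exists i, p = 'X_i.
Proof.
move=> /computable_realizable[C [v [h [nC _ /(_ p (mem_head _ _))[i iC <-]]]]].
have [Ca -> hi] := nC i iC.
have noarg j : j \notin gate_args (gate_at C i).
  by apply/negP => /Ca[_ hj]; have := leq_trans hj hi.
case: (gate_at C i) noarg => [k|c|js|js] /= noarg; [by right; exists k|by left; exists c| |].
  have -> : js = [::] by case: js noarg => // j js /(_ j); rewrite mem_head.
  by left; exists 0; rewrite big_nil mpolyC0.
have -> : js = [::] by case: js noarg => // j js /(_ j); rewrite mem_head.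
by left; exists 1; rewrite big_nil mpolyC1.
Qed.

Lemma computableC (F : fieldType) N (c : F) D s : computable (c%:MP : {mpoly F[N]}) D s.
Proof.
exists [:: GConst c]; split.
- split=> // i; rewrite ltnS leqn0 => /eqP -> j //.
- by rewrite /circuit_depth /circuit_depths /= big_seq1 big_nil.
- by rewrite /circuit_size big_seq1.
Qed.

Lemma Txz_var (F : fieldType) n (i : 'I_n.+2) :
  (exists a, Txz ('X_i : {mpoly F[n.+2]}) = a%:P) \/ Txz ('X_i : {mpoly F[n.+2]}) = 'X.
Proof.
case: (unliftP ord0 i) => [i' ->|->]; last by left; rewrite TxzT; exists 'X.
case: (ord_maxP i') => [->|[j ->]]; first by right; rewrite lift0_max Txzz.
by left; exists ('X_j)%:P; rewrite -/(xindex j) Txzx.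
Qed.

Lemma KI_feasible : exists e : nat, forall (F : fieldType), [pchar F] =i pred0 ->
  forall n k l : nat, (1 < k)%N ->
  forall (P : {mpoly F[n.+2]}) (R : 'I_l -> {mpoly F[n.+1]}),
  T_regularized P -> monic_in_z P ->
  (forall i, [/\ truncated k (R i), nondegenerate P (R i)
               & approx_root k P (R i)]) ->
  forall (sigma mu rho : nat) (g : {mpoly F[sigma]}) (S : 'I_n -> {set 'I_mu}),
  design sigma rho S ->
  ~ divides (Qpoly k R) P ->
  divides (subst_x (KI g S) (Qpoly k R)) (subst_x (KI g S) P) ->
  forall W D, (1 < W)%N -> feas W D 1 P -> (l <= W ^ 2)%N ->
  (lift_order k P <= W ^ 2)%N -> ((tdeg g).+1 <= W ^ 2)%N ->
  (rho ^ tdeg g <= W ^ 2)%N -> feas W (D + 29 + 27) e g.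
Proof.
(* The order of quantifiers is the point: the exponent depends on b and c alone, hence is an
   absolute constant for b = 1 and c = 2. *)
suff [f H] : exists f : nat -> nat -> nat, forall b c (F : fieldType), [pchar F] =i pred0 ->
  forall n k l : nat, (1 < k)%N ->
  forall (P : {mpoly F[n.+2]}) (R : 'I_l -> {mpoly F[n.+1]}),
  T_regularized P -> monic_in_z P ->
  (forall i, [/\ truncated k (R i), nondegenerate P (R i)
               & approx_root k P (R i)]) ->
  forall (sigma mu rho : nat) (g : {mpoly F[sigma]}) (S : 'I_n -> {set 'I_mu}),
  design sigma rho S ->
  ~ divides (Qpoly k R) P ->
  divides (subst_x (KI g S) (Qpoly k R)) (subst_x (KI g S) P) ->
  forall W D, (1 < W)%N -> feas W D b P -> (l <= W ^ c)%N ->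
  (lift_order k P <= W ^ c)%N -> ((tdeg g).+1 <= W ^ c)%N ->
  (rho ^ tdeg g <= W ^ c)%N -> feas W (D + 29 + 27) (f b c) g.
  by exists (f 1%N 2%N); exact: (H 1%N 2%N).
exists (fun b c => 729 * (3 * (9 * (729 * (3 * b + 19) + 252 * c + 6) + 3 * c + 23)
   + 6 * c + 33) + 253 * c + 3)%N.
move=> b c F char0 n k l k1 P R Preg Pmon PR sigma mu rho g S [Ss Sr] Qn Qd.
move=> W D W2 PD lc Mc dc rc.
have [G [[G0 GKI GD] _]] := witness char0 k1 Preg Pmon PR Qn Qd.
have GD' := GD W D b c W2 PD lc Mc.
exact: (KI_extract char0 Ss G0 GKI W2 Sr dc rc GD').
Qed.

Theorem theorem8p15 :
  exists a c1 c2 : nat, forall c : nat, exists N : nat,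
  forall n : nat, (N <= n)%N ->
  forall F : fieldType, [pchar F] =i pred0 ->
  forall k : nat, (1 < k)%N ->
  forall (P : {mpoly F[n.+2]}) (l : nat) (R : 'I_l -> {mpoly F[n.+1]})
    (Delta s : nat),
  computable P Delta s -> (s <= poly_bound c [:: n])%N ->
  T_regularized P -> monic_in_z P ->
  (forall i, [/\ truncated k (R i), nondegenerate P (R i)
               & approx_root k P (R i)]) ->
  forall (sigma d : nat) (g : {mpoly F[sigma]}), tdeg g = d ->
  forall (mu rho : nat) (S : 'I_n -> {set 'I_mu}), design sigma rho S ->
  let Q := Qpoly k R in
  let QKI := subst_x (KI g S) Q in
  let PKI := subst_x (KI g S) P in
  let Delta' := (a * Delta)%N in
  let s' := size_bound c1 c2 s l k (tdeg P) rho d in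
  (~ divides Q P -> divides QKI PKI -> computable g Delta' s')
  /\
  ((forall C : circuit F sigma,
      computes C g -> (circuit_depth C <= Delta')%N ->
      (s' < circuit_size C)%N) ->
   (divides Q P <-> divides QKI PKI)).
Proof.
have [e KIe] := KI_feasible.
(* 58 = 29 + 27 + 1 + 1: the circuit has depth Delta + 57, which is at most 58 Delta for Delta > 0.
   With n >= 2 the design has two sets of distinct indices, so that rho is positive. *)
exists 58%N, e.+1, e.+1 => c; exists 2%N => n n2 F char0 k k1 P l R Delta s.
move=> Pcomp _ Preg Pmon PR sigma d g gd mu rho S Sdes Q QKI PKI Delta' s'.
have main : ~ divides Q P -> divides QKI PKI -> computable g Delta' s'.
  move=> Qn Qd; have [G [[G0 GKI _] Ptriv]] := witness char0 k1 Preg Pmon PR Qn Qd.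
  have [D0|Dpos] := posnP Delta.
    case: Ptriv; rewrite D0 in Pcomp.
    have [[a ->]|[i ->]] := computable_depth0 Pcomp; last exact: Txz_var.
    by left; rewrite TxzC; exists (a%:MP)%:P.
  have [Ssig Srho] := Sdes.
  have rho0 : (0 < rho)%N.
    by apply: leq_ltn_trans (Srho (Ordinal (ltnW n2)) (Ordinal n2) _).
  (* For rho = 1 the base rho log k may be 1, leaving no room for a size that depends on d; here g
     is a constant. *)
  have [rho1|rho2] := leqP rho 1.
    have [|a ->] := KI_disjoint_const char0 Ssig G0 GKI; last exact: computableC.
    by move=> i j /Srho H; rewrite -ltnS; apply: leq_trans H rho1.
  set Y := (sumn [:: s; l; k; tdeg P]).+1.
  have YE : Y = (s + l + k + tdeg P).+1 by rewrite /Y /=; lia.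
  (* Y dominates s, l, k and deg P. As rho >= 2, the other factor dominates d + 1 and rho^d, and a
     power of W splits into the two factors of s'. *)
  pose W := (Y * rho ^ d.+1)%N.
  have rhoge m : (m <= rho ^ m)%N by apply: ltnW; apply: ltn_expl.
  have rpos m : (0 < rho ^ m)%N by rewrite expn_gt0 rho0.
  have YW : (Y <= W)%N by rewrite /W leq_pmulr.
  have rW : (rho ^ d.+1 <= W)%N by rewrite /W leq_pmull.
  have W2 : (1 < W)%N by apply: leq_trans YW; lia.
  have WW m : (m <= W)%N -> (m <= W ^ 2)%N.
    by move=> mW; apply: leq_trans mW _; rewrite -{1}(expn1 W) leq_exp2l.
  have PD : feas W Delta 1 P.
    split; last by rewrite expn1; apply: leq_trans YW; lia.
    apply: realizable_mono (computable_realizable Pcomp) => //.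
    by rewrite expn1; apply: leq_trans YW; lia.
  have [gD _] : feas W (Delta + 29 + 27) e g.
    apply: (KIe _ char0 _ _ _ k1 P R Preg Pmon PR _ _ _ g S Sdes Qn Qd) => //.
    - by apply: WW; apply: leq_trans YW; lia.
    (* The product of deg P and k in [lift_order] is what asks for the exponent 2. *)
    - apply: (@leq_trans (Y * Y)); last by rewrite -mulnn leq_mul.
      by rewrite /lift_order; nia.
    - by rewrite gd; apply/WW/(leq_trans _ rW).
    - by rewrite gd; apply/WW/(leq_trans _ rW); rewrite leq_exp2l.
  have [C [Cg CD Cs]] := realizable_computable gD.
  exists C; split=> //; first by apply: leq_trans CD _; rewrite /Delta'; lia.
  apply: leq_trans Cs _; apply: (@leq_trans (W ^ e.+1)).
    by rewrite ltn_exp2l.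
  rewrite /s' /size_bound /poly_bound -/Y {1}/W [in leqLHS]expnMn; apply: leq_mul.
    by rewrite mulSn leq_addr.
  have L0 : (0 < up_log 2 k)%N by rewrite up_log_gt0.
  apply: (@leq_trans ((rho * up_log 2 k) ^ (d.+1 * e.+1))).
    by rewrite -expnM leq_exp2r ?muln_gt0 // leq_pmulr.
  rewrite leq_exp2l; last by apply: leq_trans rho2 _; rewrite leq_pmulr.
  rewrite mulnC leq_mul //= addn0 expnS leq_pmulr // expn_gt0.
  by [].
split=> // hard; split.
  move=> [H PH]; exists (subst_x (KI g S) H).
  by rewrite /PKI PH /subst_x rmorphM.
move=> Qd; apply: Classical_Prop.NNPP => Qn.
have [C [Cg CD Cs]] := main Qn Qd.
by have := hard C Cg CD; rewrite ltnNge Cs.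
Qed.
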